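(* Given $\delta'>0$, let $q=1+\delta'$, and let $(u,v)$ satisfy the boundary conditions and the divergence-free condition of the context. For $\frac1{1+\delta'}\le\delta\le1$, $$\varepsilon^{\frac\gamma2+\frac1{4q}}\|u\|_{L^\infty}+\varepsilon^{\frac\gamma2+\frac1{4q}+\frac12}\|v\|_{L^\infty}\lesssim\|u,v\|_Z.$$
   Context: $R_0>0$, $\theta_0>0$ (small), $0<\varepsilon\le1$, $\gamma\in(0,\frac14)$. $(\omega,R)\in\Omega=(0,\theta_0)\times(R_0,\infty)$; $r=r(R)=R_0+\sqrt\varepsilon(R-R_0)$; $\iint=\int_0^{\theta_0}\int_{R_0}^\infty\cdot\,dR\,d\omega$. Boundary conditions: $u=v=0$ on $\{\omega=0\}$ and on $\{R=R_0\}$; $\varepsilon v_\omega+ru_R=0$ on $\{\omega=\theta_0\}$ (and, for the associated pressure $P$, $Pr=2\varepsilon u_\omega$ there). Divergence-free condition: $u_\omega+\partial_R(rv)=0$. Norm: $\|u,v\|_Z^2=\iint(u^2r^\delta+u_\omega^2r^\delta+u_R^2r^{1+\delta})+\iint(\varepsilon v_\omega^2r^\delta+|\partial_R(rv)|^2r^\delta)+\varepsilon^\gamma(\iint|u_R|^{2q}r^{q+\alpha})^{1/q}+\varepsilon^\gamma(\iint|v_R|^{2q}r^{q+\alpha})^{1/q}+\varepsilon^\gamma(\iint|u_\omega|^{2q})^{1/q}+\varepsilon^{\gamma+1}(\iint|v_\omega|^{2q}r^{-\frac q{2p}})^{1/q}$, where $p$ is the Hölder conjugate of $q$ and $0<\frac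 qp\le\alpha\le\frac{q\delta}2$ ($\delta'$ being small). The implicit constant is independent of $\varepsilon$ and of $(u,v)$. *)

(* Defs.v *)
From mathcomp Require Import all_boot all_order all_algebra.
From mathcomp Require Import all_classical all_reals all_analysis.

Set Implicit Arguments.
Unset Strict Implicit.
Unset Printing Implicit Defensive.

Import Order.TTheory GRing.Theory Num.Theory.
Import numFieldNormedType.Exports.

Local Open Scope classical_set_scope.
Local Open Scope ring_scope.

Section Domain.
Context {R : realType}.
Implicit Types (eps : R) (f g phi : R * R -> R).

Local Notation leb2 := (@lebesgue_measure R \x @lebesgue_measure R)%E.

(* A point x : R * R of the plane is x = (omega, R). *)
Definition Omega (th0 R0 : R) : set (R * R) := `]0, th0[ `*` `]R0, +oo[.

Definition rvar (R0 : R) eps (x : R * R) : R := R0 + Num.sqrt eps * (x.2 - R0).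

(* Integrability up to the boundary of Omega, so that traces make sense. *)
Definition loc_integrable (th0 R0 : R) f : Prop :=
  forall M : R, leb2.-integrable
    (Omega th0 R0 `&` [set x | x.2 <= M]) (EFin \o f).

(* C^1 functions with compact support in D. *)
Definition test_fun (D : set (R * R)) phi : Prop :=
  [/\ continuous phi,
      forall x, derivable phi x (1, 0) /\ derivable phi x (0, 1),
      continuous (fun x => 'D_(1, 0) phi x),
      continuous (fun x => 'D_(0, 1) phi x) &
      exists K : set (R * R),
        [/\ compact K, K `<=` D & forall x, ~ K x -> phi x = 0] ].

(* g is the weak derivative of f in the direction e. *)
Definition weak_deriv (e : R * R) (th0 R0 : R) f g : Prop :=
  [/\ loc_integrable th0 R0 f, loc_integrable th0 R0 g &
      forall phi, test_fun (Omega th0 R0) phi ->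
        \int[leb2]_(x in Omega th0 R0) (f x * 'D_e phi x) =
        - \int[leb2]_(x in Omega th0 R0) (g x * phi x) ].

Definition weak_dw := weak_deriv (1, 0).
Definition weak_dR := weak_deriv (0, 1).

(* Vanishing trace on a side of Omega: the averages of f over the strips of width
   h along that side, tested against compactly supported functions of the
   tangential variable, tend to 0 with h.  Here dist is the distance to the
   side, tang the tangential coordinate and I its (open) range.  If f is
   continuous up to the open side, this says that f = 0 there; if f is W^{1,1}
   near the side, that its Sobolev trace is 0. *)
Definition zero_trace (th0 R0 : R) (dist tang : R * R -> R) (I : set R) f : Prop :=
  forall psi : R -> R, continuous psi ->
    (exists K : set R,
      [/\ compact K, K `<=` I & forall s, ~ K s -> psi s = 0]) ->
    h^-1 * \int[leb2]_(x in Omega th0 R0 `&` [set x | dist x < h])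
             (f x * psi (tang x)) @[h --> 0^'+] --> 0.

Definition zero_at_w0 (th0 R0 : R) :=
  zero_trace th0 R0 (fun x => x.1) (fun x => x.2) `]R0, +oo[.
Definition zero_at_wth0 (th0 R0 : R) :=
  zero_trace th0 R0 (fun x => th0 - x.1) (fun x => x.2) `]R0, +oo[.
Definition zero_at_R0 (th0 R0 : R) :=
  zero_trace th0 R0 (fun x => x.2 - R0) (fun x => x.1) `]0, th0[.

(* uw, uR, vw stand for the derivatives u_omega, u_R, v_omega. *)
Definition boundary_conditions (th0 R0 : R) eps
    (u v uw uR vw P : R * R -> R) : Prop :=
  [/\ zero_at_w0 th0 R0 u /\ zero_at_w0 th0 R0 v,
      zero_at_R0 th0 R0 u /\ zero_at_R0 th0 R0 v,
      zero_at_wth0 th0 R0 (fun x => eps * vw x + rvar R0 eps x * uR x) &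
      zero_at_wth0 th0 R0 (fun x => P x * rvar R0 eps x - 2 * eps * uw x) ].

(* rvR stands for the derivative of r v with respect to R. *)
Definition divergence_free (th0 R0 : R) (uw rvR : R * R -> R) : Prop :=
  {ae leb2, forall x, Omega th0 R0 x -> uw x + rvR x = 0}.

Local Open Scope ereal_scope.

Definition Linfty (th0 R0 : R) f : \bar R :=
  'N[leb2]_(+oo) [ (EFin \o f) \_ (Omega th0 R0) ].

Definition iint (th0 R0 : R) f : \bar R :=
  \int[leb2]_(x in Omega th0 R0) (f x)%:E.

Definition Znorm_sq (th0 R0 : R) eps (gam q p alpha delta : R)
    (u uw uR vw vR rvR : R * R -> R) : \bar R :=
  let r := rvar R0 eps in
  iint th0 R0 (fun x => u x ^+ 2 * r x `^ delta + uw x ^+ 2 * r x `^ delta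
                        + uR x ^+ 2 * r x `^ (1 + delta))%R
  + iint th0 R0 (fun x => eps * vw x ^+ 2 * r x `^ delta
                          + `|rvR x| ^+ 2 * r x `^ delta)%R
  + (eps `^ gam)%:E *
      iint th0 R0 (fun x => `|uR x| `^ (2 * q) * r x `^ (q + alpha))%R `^ q^-1
  + (eps `^ gam)%:E *
      iint th0 R0 (fun x => `|vR x| `^ (2 * q) * r x `^ (q + alpha))%R `^ q^-1
  + (eps `^ gam)%:E *
      iint th0 R0 (fun x => `|uw x| `^ (2 * q))%R `^ q^-1
  + (eps `^ (gam + 1))%:E *
      iint th0 R0 (fun x => `|vw x| `^ (2 * q) * r x `^ (- (q / (2 * p))))%R
        `^ q^-1.

Definition Znorm (th0 R0 : R) eps gam q p alpha delta u uw uR vw vR rvR : \bar R :=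
  Znorm_sq th0 R0 eps gam q p alpha delta u uw uR vw vR rvR `^ 2^-1.

End Domain.

(* Main.v *)
Require Import Defs.
From mathcomp Require Import all_boot all_order all_algebra.
From mathcomp Require Import all_classical all_reals all_analysis.
From mathcomp Require Import measurable_realfun ess_sup_inf ring lra.

Set Implicit Arguments.
Unset Strict Implicit.
Unset Printing Implicit Defensive.

Import Order.TTheory GRing.Theory Num.Theory.
Import numFieldNormedType.Exports.

Local Open Scope classical_set_scope.
Local Open Scope ring_scope.

(* The bound is a Morrey embedding on boxes whose length in R follows the weight.
   On the box ]0, th0[ x ]R1, R1 + r1[ with r1 = r(R1) one has r1 <= r <= 2 r1, so
   the Z-norm controls the L^2q norms of both partial derivatives there, up to powers
   of r1.  For nested rectangles the difference of the averages of f is an integral of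
   |f_omega| or |f_R| over the larger rectangle, by the definition of weak derivatives
   with a spline test function; by Hoelder, halving the sides again and again gives a
   geometric series, convergent because 2q > 2, and the vanishing trace on omega = 0
   bounds the average over the whole box.  The total is
     |f| <= C (th0 |f_omega|_2q + r1 |f_R|_2q) (th0 r1)^(-1/2q)
   first for averages over all rectangles, then almost everywhere by Fubini and the
   one-dimensional Lebesgue differentiation theorem.  The resulting powers of r1 are
   nonpositive because q/p = q - 1 <= alpha (for f_R) and q <= 2 (for
   v_omega), hence they are bounded by powers of R0. *)

(** * C1 splines *)

(** A weakly differentiable f has neither values at points nor a fundamental theorem along lines, so
    every estimate is made on averages, and the indicators of rectangles enter only as limits of C^1
    functions supported strictly inside Omega. The cell length r1 is dictated by the weights: the
    term with f_R collects r1^(1 - (q + alpha)/2q - 1/2q) = r1^((q - 1 - alpha)/2q), and the one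
    with v_omega collects r1^((q - 1)/4q - 1/2q), so cells far out obey the same bound as the one at
    R0. Since sqrt eps <= 1, the function r at most doubles on a cell whatever eps is; apart from
    this, eps enters only through the prefactors eps^gamma and eps^(gamma + 1) of the norm.
    Anchoring the chain of averages at the side omega = 0 bounds f by its derivatives alone, without
    its own L^2q norm, which the Z-norm does not contain. *)

Lemma is_derive_quadratic (R : realType) (f : R -> R) (x l K : R) :
  (forall z, `|f z - f x - l * (z - x)| <= K * (z - x) ^+ 2) ->
  is_derive x 1 f l.
Proof.
move=> H.
have K0 : 0 <= K.
  have := H (x + 1); rewrite [x + 1 - x]addrC addKr expr1n !mulr1.
  exact: (le_trans (normr_ge0 _)).
apply/is_derive1_caratheodory.
(* Caratheodory's slope function; the quadratic bound keeps it within K |z - x| of l. *)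
exists (fun z => if z == x then l else (f z - f x) / (z - x)); split.
- move=> z; case: eqP => [->|/eqP zx]; first by rewrite !subrr mulr0.
  by rewrite divfK// subr_eq0.
- apply/cvgrPdist_le => /= e e0; rewrite eqxx.
  near=> z; case: eqP => [_|/eqP zx]; first by rewrite subrr normr0 ltW.
  have zx' : z - x != 0 by rewrite subr_eq0.
  have nz : 0 < `|z - x| by rewrite normr_gt0.
  rewrite distrC -(ler_pM2r nz) -normrM mulrBl divfK//.
  apply: le_trans (H z) _.
  rewrite -(@real_normK _ (z - x)) ?num_real// expr2 mulrA ler_pM2r//.
  (* K may be 0; K + 1 can be divided by. *)
  apply: (@le_trans _ _ ((K + 1) * `|z - x|)).
    by rewrite ler_pM2r// lerDl.
  rewrite -ler_pdivlMl; last by rewrite ltr_wpDl.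
  near: z; apply/nbhs_ballP; exists ((K + 1)^-1 * e).
    by rewrite /= mulr_gt0// invr_gt0 ltr_wpDl.
  by move=> z /=; rewrite distrC => /ltW.
- by rewrite eqxx.
Unshelve. all: by end_near. Qed.

Lemma is_derive_affine (R : realType) (f : R -> R) (x l : R) :
  (forall z, f z - f x = l * (z - x)) -> is_derive x 1 f l.
Proof.
move=> H; apply: (@is_derive_quadratic _ _ _ _ 0) => z.
by rewrite H subrr normr0 mul0r.
Qed.

Lemma continuous_sqr_at (R : realType) (f : R -> R) (x : R) :
  {for x, continuous f} -> {for x, continuous (fun x => f x ^+ 2)}.
Proof.
move=> cf; rewrite (_ : (fun _ => _) = f * f); first exact: continuousM.
by apply/funext => y; rewrite expr2.
Qed.

Section spline.
Variable R : realType.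
Implicit Types x a b c e : R.

Definition pospart x := Num.max x 0.

Lemma continuous_pospart : continuous pospart.
Proof.
move=> x; apply: (@continuous_max R R (fun x => x) (cst 0) x) => //.
exact: cvg_cst.
Qed.

Lemma pospart_id x : 0 <= x -> pospart x = x. Proof. by move=> /max_idPl. Qed.
Lemma pospart_0 x : x <= 0 -> pospart x = 0. Proof. by move=> /max_idPr. Qed.

(** Squaring removes the kink at 0: for each of the four sign patterns of z and x the remainder is
    at most (z - x)^2. *)
Lemma is_derive_pospart_sqr x : is_derive x 1 (fun z => pospart z ^+ 2) (2 * pospart x).
Proof.
apply: (@is_derive_quadratic _ _ _ _ 1) => z; rewrite mul1r.
rewrite ler_norml; apply/andP.
have s0 := sqr_ge0 (z - x).
have [z0|z0] := leP 0 z; have [x0|x0] := leP 0 x;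
  rewrite ?(pospart_id z0) ?(pospart_id x0) ?(pospart_0 (ltW z0)) ?(pospart_0 (ltW x0));
  split; rewrite ?expr0n /=; nra.
Qed.

(** The derivative is carried as data, so that products of two such functions are test functions
    with explicit partial derivatives. The support keeps a positive distance from both ends. *)
Definition C1c a c (k k' : R -> R) : Prop :=
  [/\ forall x, is_derive x 1 k (k' x), continuous k' &
      exists a' c', [/\ a < a', c' < c &
        forall x, ~ (a' <= x <= c') -> k x = 0 /\ k' x = 0]].

Lemma C1c_continuous a c k k' : C1c a c k k' -> continuous k.
Proof.
move=> [dk _ _] x; apply: differentiable_continuous.
by apply/derivable1_diffP; exact: ex_derive.
Qed.

(* Tends to \1_]a, c[ as e -> 0; the support [a + e, c - e] stays inside ]a, c[, so that
   intervals touching the boundary of the domain are allowed. *)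
Definition cutoff a c e x :=
  let w := pospart (x - a - e) ^+ 2 * pospart (c - e - x) ^+ 2 in w / (e + w).

Lemma cutoff_ge0 a c e x : 0 < e -> 0 <= cutoff a c e x.
Proof.
move=> e0; rewrite /cutoff; set w := _ * _ ^+ 2.
have w0 : 0 <= w by apply: mulr_ge0; exact: sqr_ge0.
by rewrite divr_ge0// ltW// ltr_wpDr.
Qed.

Lemma cutoff_le1 a c e x : 0 < e -> cutoff a c e x <= 1.
Proof.
move=> e0; rewrite /cutoff; set w := _ * _ ^+ 2.
have w0 : 0 <= w by apply: mulr_ge0; exact: sqr_ge0.
have ew : 0 < e + w by rewrite ltr_wpDr.
by rewrite ler_pdivrMr// mul1r lerDr ltW.
Qed.

(** The denominator [e + w] is at least [e], so the quotient inherits the C^1 regularity of [w], a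
    product of two squared positive parts. *)
Lemma cutoff_C1c a0 c0 a c e : a0 <= a -> c <= c0 -> 0 < e ->
  exists k', C1c a0 c0 (cutoff a c e) k'.
Proof.
move=> a0a cc0 e0.
pose u x := pospart (x - a - e); pose v x := pospart (c - e - x).
pose w x := u x ^+ 2 * v x ^+ 2.
have w0 x : 0 < e + w x by rewrite ltr_wpDr//; apply: mulr_ge0; exact: sqr_ge0.
pose w' x := u x ^+ 2 * (- (2 * v x)) + v x ^+ 2 * (2 * u x).
have cu : continuous u.
  move=> x; apply: (@continuous_comp _ _ _ (fun x => x - a - e) pospart).
    by apply: continuousB; [apply: continuousB|]; try exact: cvg_cst; exact: cvg_id.
  exact: continuous_pospart.
have cv : continuous v.
  move=> x; apply: (@continuous_comp _ _ _ (fun x => c - e - x) pospart).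
    by apply: continuousB; try exact: cvg_cst; exact: cvg_id.
  exact: continuous_pospart.
have cu2 : continuous (fun x => u x ^+ 2).
  by move=> x; exact/continuous_sqr_at/cu.
have cv2 : continuous (fun x => v x ^+ 2).
  by move=> x; exact/continuous_sqr_at/cv.
have cw : continuous w by move=> x; exact: (continuousM (cu2 x) (cv2 x)).
have cew : continuous (fun x => e + w x).
  by move=> x; apply: continuousD; [exact: cvg_cst|exact: cw].
have dw x : is_derive x 1 w (w' x).
  have du : is_derive x 1 (fun x => u x ^+ 2) (2 * u x).
    rewrite -[X in is_derive _ _ _ X]mulr1.
    apply: (@is_derive1_comp _ (fun z => pospart z ^+ 2) (fun x => x - a - e)).
      exact: is_derive_pospart_sqr.
    by apply: is_derive_affine => z; ring.
  have dv : is_derive x 1 (fun x => v x ^+ 2) (- (2 * v x)).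
    rewrite -mulrN1.
    apply: (@is_derive1_comp _ (fun z => pospart z ^+ 2) (fun x => c - e - x)).
      exact: is_derive_pospart_sqr.
    by apply: is_derive_affine => z; ring.
  exact: (is_deriveM du dv).
exists (fun x => w x * - (e + w x) ^- 2 * w' x + (e + w x)^-1 * w' x); split.
- move=> x.
  have dew : is_derive x 1 (fun x => e + w x) (w' x).
    by rewrite -[w' x]add0r; apply: is_deriveD.
  have dV : is_derive x 1 (fun x => (e + w x)^-1) (- (e + w x) ^- 2 * w' x).
    by apply: is_deriveV; rewrite gt_eqF.
  have := is_deriveM (dw x) dV.
  by rewrite -mulrA.
- move=> x.
  have cV : {for x, continuous (fun x => (e + w x)^-1)}.
    by apply: continuousV; [rewrite gt_eqF|exact: cew].
  have cw' : {for x, continuous w'}.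
    rewrite /w'; apply: continuousD; apply: continuousM; [exact: cu2|apply: continuousN|exact: cv2|].
      by apply: continuousM; [exact: cvg_cst|exact: cv].
    by apply: continuousM; [exact: cvg_cst|exact: cu].
  have cV2 : {for x, continuous (fun x => - (e + w x) ^- 2)}.
    apply: continuousN; rewrite (_ : (fun _ => _) = (fun x => ((e + w x)^-1) ^+ 2)).
      exact: continuous_sqr_at.
    by apply/funext => y; rewrite exprVn.
  exact: (continuousD (continuousM (continuousM (cw x) cV2) cw')
    (continuousM cV cw')).
- exists (a + e), (c - e); split; first by rewrite ltr_pwDr.
    by rewrite ltrBlDr ltr_pwDr.
  move=> x /negP; rewrite negb_and -!ltNge => xac.
  have : u x = 0 \/ v x = 0.
    case/orP: xac => h; [left; rewrite /u|right; rewrite /v]; rewrite pospart_0//; lra.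
  rewrite /cutoff -/(u x) -/(v x) -/(w x) /w' /w.
  by case=> ->; rewrite ?expr0n/= ?(mulr0,mul0r,addr0,oppr0).
Qed.

(** Inside the interval w tends to some w0 > 0, so the quotient tends to w0 / (0 + w0) = 1.
    Elsewhere, endpoints included, one of the two positive parts is 0 for every n. *)
Lemma cutoff_cvg a c (e : R^nat) x : (forall n, 0 < e n) -> e @ \oo --> 0 ->
  cutoff a c (e n) x @[n --> \oo] --> (\1_`]a, c[ x : R).
Proof.
move=> e0 cve; rewrite indicE; case: (boolP (x \in _)) => [|xac].
  rewrite inE /= in_itv /= => /andP[ax xc].
  pose w0 := pospart (x - a) ^+ 2 * pospart (c - x) ^+ 2.
  have w00 : 0 < w0.
    by rewrite /w0 !pospart_id ?subr_ge0 ?ltW//; rewrite mulr_gt0// exprn_gt0// subr_gt0.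
  have cw : pospart (x - a - e n) ^+ 2 * pospart (c - e n - x) ^+ 2 @[n --> \oo] --> w0.
    have h (f : R -> R) : continuous f -> f (e n) @[n --> \oo] --> f 0.
      by move=> cf; exact: (cvg_comp e f cve (cf 0)).
    have -> : w0 = pospart (x - a - 0) ^+ 2 * pospart (c - 0 - x) ^+ 2 by rewrite /w0 !subr0.
    apply: (h (fun y => pospart (x - a - y) ^+ 2 * pospart (c - y - x) ^+ 2)) => y.
    have p1 : {for y, continuous (fun y => pospart (x - a - y))}.
      apply: (@continuous_comp _ _ _ (fun y => x - a - y) pospart).
        by apply: continuousB; try exact: cvg_cst; exact: cvg_id.
      exact: continuous_pospart.
    have p2 : {for y, continuous (fun y => pospart (c - y - x))}.
      apply: (@continuous_comp _ _ _ (fun y => c - y - x) pospart).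
        by apply: continuousB; [apply: continuousB|]; try exact: cvg_cst; exact: cvg_id.
      exact: continuous_pospart.
    exact: (continuousM (continuous_sqr_at p1) (continuous_sqr_at p2)).
  have -> : (true%:R : R) = w0 / (0 + w0) by rewrite add0r divff ?gt_eqF.
  by apply: cvgM => //; apply: cvgV; [rewrite add0r gt_eqF|exact: cvgD].
have H n : cutoff a c (e n) x = 0.
  rewrite /cutoff.
  have [xa|xa] := leP x a.
    by rewrite pospart_0 ?expr0n ?mul0r//; have := e0 n; lra.
  have [xc|xc] := leP c x.
    by rewrite (pospart_0 (x := c - _ - _)) ?expr0n ?mulr0 ?mul0r//; have := e0 n; lra.
  by move: xac; rewrite notin_setE /= in_itv /= xa xc.
under eq_fun do rewrite H; exact: cvg_cst.
Qed.

(** The continuous piecewise linear step rising from 0 to 1 on [0, e], and its C^1 primitive that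
    vanishes on the negative half-line. *)
Definition ramp e x := (pospart x - pospart (x - e)) / e.
Definition iramp e x := (pospart x ^+ 2 - pospart (x - e) ^+ 2) / (2 * e).

Lemma ramp_le0 e x : 0 < e -> x <= 0 -> ramp e x = 0.
Proof. by move=> e0 x0; rewrite /ramp !pospart_0 ?subrr ?mul0r//; lra. Qed.

Lemma ramp_ge e x : 0 < e -> e <= x -> ramp e x = 1.
Proof.
move=> e0 x0; rewrite /ramp !pospart_id; [|lra..].
by rewrite opprB addrC subrK divff// gt_eqF.
Qed.

Lemma ramp_itv e x : 0 < e -> 0 <= ramp e x <= 1.
Proof.
move=> e0; rewrite /ramp ler_pdivrMr// mul1r pmulr_lge0 ?invr_gt0//.
have [x0|x0] := leP 0 x; last first.
  by rewrite !pospart_0 ?subrr ?lexx ?ltW//; lra.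
have [xe|xe] := leP 0 (x - e).
  by rewrite !pospart_id//; lra.
by rewrite (pospart_0 (ltW xe)) pospart_id//; lra.
Qed.

Lemma continuous_ramp e : continuous (ramp e).
Proof.
move=> x.
have c2 : {for x, continuous (fun x => pospart (x - e))}.
  apply: (@continuous_comp _ _ _ (fun x => x - e) pospart).
    by apply: continuousB; try exact: cvg_cst; exact: cvg_id.
  exact: continuous_pospart.
apply: (continuousM (continuousB (@continuous_pospart x) c2)); exact: cst_continuous.
Qed.

Lemma is_derive_iramp e x : 0 < e -> is_derive x 1 (iramp e) (ramp e x).
Proof.
move=> e0.
have d2 : is_derive x 1 (fun x => pospart (x - e) ^+ 2) (2 * pospart (x - e)).
  rewrite -[X in is_derive _ _ _ X]mulr1.
  apply: (@is_derive1_comp _ (fun z => pospart z ^+ 2) (fun x => x - e)).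
    exact: is_derive_pospart_sqr.
  by apply: is_derive_affine => z; ring.
have := is_deriveM (is_deriveB (is_derive_pospart_sqr x) d2)
  (is_derive_cst ((2 * e)^-1) x 1).
rewrite scaler0 add0r.
suff -> : ((2 * e)^-1 *: (2 * pospart x - 2 * pospart (x - e)) : R) = ramp e x by [].
by rewrite /ramp /GRing.scale /=; field; rewrite gt_eqF.
Qed.

Lemma iramp_le0 e x : 0 < e -> x <= 0 -> iramp e x = 0.
Proof. by move=> e0 x0; rewrite /iramp !pospart_0 ?subrr ?mul0r//; lra. Qed.

Lemma iramp_ge e x : 0 < e -> e <= x -> iramp e x = x - e / 2.
Proof.
by move=> e0 x0; rewrite /iramp !pospart_id; [field; rewrite gt_eqF|lra..].
Qed.

Lemma iramp_incr e x y : 0 < e -> x <= y ->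
  0 <= iramp e y - iramp e x <= y - x.
Proof.
move=> e0 xy.
have d (z : R) : is_derive z 1 (iramp e) (ramp e z) by exact: is_derive_iramp.
have ci : {within `[x, y], continuous (iramp e)}.
  apply: continuous_subspaceT => z.
  by apply: differentiable_continuous; apply/derivable1_diffP; case: (d z).
have [z _ ->] := MVT_segment xy (fun z _ => d z) ci.
have /andP[r0 r1] := ramp_itv z e0.
by have yx : 0 <= y - x; [rewrite subr_ge0|rewrite mulr_ge0//= ler_piMl].
Qed.

(* kern a c e approximates \1_]a, c[ / (c - a) and has total mass 1 and support
   [a + e, c - e]: a difference of two primitives ikern over nested intervals is thus
   a compactly supported test function bounded by 1. *)
Definition kern a c e x :=
  (ramp e (x - (a + e)) - ramp e (x - (c - 2 * e))) / (c - a - 3 * e).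
Definition ikern a c e x :=
  (iramp e (x - (a + e)) - iramp e (x - (c - 2 * e))) / (c - a - 3 * e).

Lemma is_derive_ikern a c e x : 0 < e ->
  is_derive x 1 (ikern a c e) (kern a c e x).
Proof.
move=> e0.
have d y : is_derive x 1 (fun x => iramp e (x - y)) (ramp e (x - y)).
  rewrite -[X in is_derive _ _ _ X]mulr1.
  apply: (@is_derive1_comp _ (iramp e) (fun x => x - y)).
    exact: is_derive_iramp.
  by apply: is_derive_affine => z; ring.
have := is_deriveM (is_deriveB (d (a + e)) (d (c - 2 * e)))
  (is_derive_cst ((c - a - 3 * e)^-1) x 1).
rewrite scaler0 add0r.
suff -> : ((c - a - 3 * e)^-1 *: (ramp e (x - (a + e)) - ramp e (x - (c - 2 * e)))
  : R) = kern a c e x by [].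
by rewrite /kern /GRing.scale /= mulrC.
Qed.

Lemma continuous_kern a c e : continuous (kern a c e).
Proof.
move=> x.
have cr y : {for x, continuous (fun x => ramp e (x - y))}.
  apply: (@continuous_comp _ _ _ (fun x => x - y) (ramp e)).
    by apply: continuousB; try exact: cvg_cst; exact: cvg_id.
  exact: continuous_ramp.
apply: (continuousM (continuousB (cr _) (cr _))); exact: cst_continuous.
Qed.

(** The two arguments of [iramp] differ by exactly c - a - 3 e, the normalizing denominator, and
    [iramp] is nondecreasing with slope at most 1. *)
Lemma ikern_itv a c e x : 0 < e -> 3 * e < c - a -> 0 <= ikern a c e x <= 1.
Proof.
move=> e0 eac; have eac0 : 0 < c - a - 3 * e by rewrite subr_gt0.
have : x - (c - 2 * e) <= x - (a + e) by lra.
move=> /(iramp_incr e0).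
rewrite /ikern ler_pdivrMr// mul1r pmulr_lge0 ?invr_gt0//.
by have -> : x - (a + e) - (x - (c - 2 * e)) = c - a - 3 * e by ring.
Qed.

Lemma ikern_lt a c e x : 0 < e -> 3 * e < c - a -> x <= a + e ->
  ikern a c e x = 0 /\ kern a c e x = 0.
Proof.
move=> e0 eac xa; rewrite /ikern /kern.
by rewrite !ramp_le0 ?iramp_le0 ?subrr ?mul0r//; lra.
Qed.

Lemma ikern_gt a c e x : 0 < e -> 3 * e < c - a -> c - e <= x ->
  ikern a c e x = 1 /\ kern a c e x = 0.
Proof.
move=> e0 eac xa; rewrite /ikern /kern.
rewrite !ramp_ge ?iramp_ge ?subrr ?mul0r//; try lra; split => //.
by field; lra.
Qed.

(** Under 6 e <= c - a the denominator c - a - 3 e is at least half of c - a. The bound is uniform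
    in e, as dominated convergence requires. *)
Lemma kern_bound a c e x : 0 < e -> 6 * e <= c - a ->
  `|kern a c e x| <= 2 / (c - a).
Proof.
move=> e0 eac.
have eac0 : 0 < c - a - 3 * e by lra.
rewrite /kern normrM normfV (gtr0_norm eac0).
apply: (@le_trans _ _ (1 / (c - a - 3 * e))).
  rewrite ler_pM2r ?invr_gt0//.
  have /andP[] := ramp_itv (x - (a + e)) e0.
  have /andP[] := ramp_itv (x - (c - 2 * e)) e0.
  by rewrite ler_norml => *; apply/andP; split; lra.
by rewrite ler_pdivrMr// mulrAC ler_pdivlMr; lra.
Qed.

Lemma kern_cvg a c (e : R^nat) x : a < c -> (forall n, 0 < e n) ->
  e @ \oo --> 0 ->
  kern a c (e n) x @[n --> \oo] --> ((\1_`]a, c[ x : R) / (c - a)).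
Proof.
move=> ac e0 cve.
have cd : (c - a - 3 * e n)^-1 @[n --> \oo] --> (c - a)^-1.
  apply: cvgV; first by rewrite subr_eq0 gt_eqF.
  rewrite -[X in _ --> X]subr0 -(mulr0 3).
  by apply: cvgB; [exact: cvg_cst|apply: cvgM => //; exact: cvg_cst].
have small y : 0 < y -> \forall n \near \oo, e n <= y.
  move=> y0; have /cvgrPdist_le /(_ y y0) := cve.
  by apply: filterS => n; rewrite sub0r normrN gtr0_norm.
apply: cvgM => //; rewrite indicE; case: (boolP (x \in _)) => [|xac].
  rewrite inE /= in_itv /= => /andP[ax xc]; apply: cvg_near_cst.
  have xa' : 0 < (x - a) / 2 by lra.
  have xc' : 0 < (c - x) / 2 by lra.
  apply: filterS2 (small _ xa') (small _ xc') => n h1 h2.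
  by rewrite ramp_ge ?(@ramp_le0 _ (x - (c - _))) ?subr0//; try lra.
have [xa|xa] := leP x a.
  apply: cvg_near_cst; have ac' : 0 < (c - a) / 2 by lra.
  apply: filterS (small _ ac') => n h; have en := e0 n.
  by rewrite !ramp_le0 ?subrr//; lra.
have [xc|xc] := leP c x; last first.
  by move: xac; rewrite notin_setE /= in_itv /= xa xc.
apply: cvg_near_cst; have xa' : 0 < (x - a) / 2 by lra.
apply: filterS (small _ xa') => n h; have en := e0 n.
by rewrite !ramp_ge ?subrr//; lra.
Qed.

End spline.

(** * Averages of weakly differentiable functions *)

Section tensor.
Variable R : realType.
Implicit Types (k b : R -> R) (x : R * R).

Lemma is_derive_fst1 k x l : is_derive x.1 1 k l ->
  is_derive x (1, 0) (fun y : R * R => k y.1) l.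
Proof. by case=> dk kl; split. Qed.

Lemma is_derive_snd1 k x l : is_derive x.2 1 k l ->
  is_derive x (0, 1) (fun y : R * R => k y.2) l.
Proof. by case=> dk kl; split. Qed.

Lemma is_derive_fst0 k x : is_derive x (0, 1) (fun y : R * R => k y.1) 0.
Proof.
have E : (fun h : R => h^-1 *: (((fun y : R * R => k y.1) \o shift x) (h *: (0, 1)) - k x.1))
   = cst 0.
  apply/funext => h /=.
  by rewrite [X in k X](_ : _ = x.1) /= ?scaler0 ?add0r ?subrr ?scaler0.
split.
  by apply: cvgP; rewrite E; exact: cvg_cst.
by rewrite /derive E; apply: cvg_lim => //; exact: cvg_cst.
Qed.

Lemma is_derive_snd0 k x : is_derive x (1, 0) (fun y : R * R => k y.2) 0.
Proof.
have E : (fun h : R => h^-1 *: (((fun y : R * R => k y.2) \o shift x) (h *: (1, 0)) - k x.2))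
   = cst 0.
  apply/funext => h /=.
  by rewrite [X in k X](_ : _ = x.2) /= ?scaler0 ?add0r ?subrr ?scaler0.
split.
  by apply: cvgP; rewrite E; exact: cvg_cst.
by rewrite /derive E; apply: cvg_lim => //; exact: cvg_cst.
Qed.

(** These products are the only test functions inserted into the weak formulation; the support is
    contained in a product of two segments, N bounding it in the unbounded direction. *)
Lemma test_fun_tensor (th0 R0 N : R) k k' b b' :
  C1c 0 th0 k k' -> C1c R0 N b b' ->
  let phi x := k x.1 * b x.2 in
  [/\ test_fun (Omega th0 R0) phi,
      forall x, 'D_(1, 0) phi x = k' x.1 * b x.2 &
      forall x, 'D_(0, 1) phi x = k x.1 * b' x.2].
Proof.
move=> kC bC phi.
have ck := C1c_continuous kC; have cb := C1c_continuous bC.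
case: kC => dk ck' [a1 [c1 [a1a c1c k0]]].
case: bC => db cb' [a2 [c2 [a2a c2c b0]]].
have D1 x : is_derive x (1, 0) phi (k' x.1 * b x.2).
  have := is_deriveM (is_derive_fst1 (dk x.1)) (is_derive_snd0 b x).
  by rewrite scaler0 add0r [_ *: _]mulrC => H; exact: H.
have D2 x : is_derive x (0, 1) phi (k x.1 * b' x.2).
  have := is_deriveM (is_derive_fst0 k x) (is_derive_snd1 (db x.2)).
  by rewrite scaler0 addr0.
have E1 x : 'D_(1, 0) phi x = k' x.1 * b x.2 by exact: derive_val.
have E2 x : 'D_(0, 1) phi x = k x.1 * b' x.2 by exact: derive_val.
have cf (f : R -> R) : continuous f -> continuous (fun x : R * R => f x.1).
  by move=> cf x; apply: (continuous_comp (@cvg_fst _ _ _ _ _)); exact: cf.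
have cs (f : R -> R) : continuous f -> continuous (fun x : R * R => f x.2).
  by move=> cf' x; apply: (continuous_comp (@cvg_snd _ _ _ _ _)); exact: cf'.
split => //; split.
- by move=> x; exact: (continuousM (cf _ ck x) (cs _ cb x)).
- by move=> x; split; [case: (D1 x)|case: (D2 x)].
- under eq_fun do rewrite E1.
  by move=> x; exact: (continuousM (cf _ ck' x) (cs _ cb x)).
- under eq_fun do rewrite E2.
  by move=> x; exact: (continuousM (cf _ ck x) (cs _ cb' x)).
- exists (`[a1, c1] `*` `[a2, c2]); split.
  + by apply: compact_setX; exact: segment_compact.
  + move=> x [/= ]; rewrite !in_itv /= => /andP[h1 h2] /andP[h3 h4].
    split; rewrite /= in_itv/= ?andbT; last exact: lt_le_trans h3.
    by rewrite (lt_le_trans a1a h1) (le_lt_trans h2 c1c).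
  + move=> x /not_andP[] /= h; rewrite /phi.
      by rewrite (k0 _ _).1 ?mul0r//; move: h; rewrite in_itv.
    by rewrite (b0 _ _).1 ?mulr0//; move: h; rewrite in_itv.
Qed.

End tensor.

(** * Integrals against bounded factors and dominated convergence *)

Section bounded_mul.
Context d (T : measurableType d) (R : realType) (mu : {measure set T -> \bar R}).
Variables (D : set T) (mD : measurable D).
Implicit Types (f k : T -> R).

Lemma integrable_mul_bounded f k B : mu.-integrable D (EFin \o f) ->
  measurable_fun D k -> (forall x, D x -> `|k x| <= B) ->
  mu.-integrable D (EFin \o (fun x => f x * k x)).
Proof.
move=> fi mk kB.
have mf := measurable_int _ fi.
apply: (le_integrable mD _ _ (integrableZl mD B fi)).
  by apply/measurable_EFinP/measurable_funM => //; exact/measurable_EFinP.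
move=> x Dx; rewrite /= lee_fin !normrM mulrC ler_wpM2r//.
exact: le_trans (kB x Dx) (ler_norm B).
Qed.

Lemma cvg_Rintegral_bounded f (k_ : (T -> R)^nat) k B :
  mu.-integrable D (EFin \o f) ->
  (forall n, measurable_fun D (k_ n)) -> measurable_fun D k ->
  (forall n x, D x -> `|k_ n x| <= B) ->
  (forall x, D x -> k_ n x @[n --> \oo] --> k x) ->
  \int[mu]_(x in D) (f x * k_ n x) @[n --> \oo] --> \int[mu]_(x in D) (f x * k x).
Proof.
move=> fi mk_ mk kB kk.
have mf : measurable_fun D f by exact/measurable_EFinP/(measurable_int _ fi).
have B0 x : D x -> 0 <= B by move=> Dx; exact: le_trans (kB 0 x Dx).
have fB : mu.-integrable D (fun x => B%:E * `|(f x)%:E|)%E.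
  by apply: (integrableZl mD B); exact: (integrable_norm fi).
have [|||||fki _ cv] := @dominated_convergence _ _ _ mu D mD
  (fun n x => (f x * k_ n x)%:E) (fun x => (f x * k x)%:E)
  (fun x => B%:E * `|(f x)%:E|)%E.
- by move=> n; apply/measurable_EFinP/measurable_funM.
- by apply/measurable_EFinP/measurable_funM.
- apply: aeW => x Dx; apply: cvg_EFin; first exact: nearW.
  by apply: cvgM; [exact: cvg_cst|exact: kk].
- exact: fB.
- apply: aeW => x n Dx /=.
  by rewrite lee_fin normrM mulrC ler_wpM2r// kB.
apply: fine_cvg; rewrite fineK//.
exact: integrable_fin_num.
Qed.

End bounded_mul.

(* s is the coordinate along which the average moves, t the other one: both weak
   derivatives are instances. *)
Section averages.
Context d (T : measurableType d) (R : realType) (mu : {measure set T -> \bar R}).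
Variables (D : set T) (mD : measurable D).
Variables (s t : T -> R) (ms : measurable_fun setT s) (mt : measurable_fun setT t).
Variables (s0 s1 t0 t1 : R) (f g : T -> R).
Hypothesis fi : mu.-integrable D (EFin \o f).
Hypothesis gi : mu.-integrable D (EFin \o g).
Hypothesis weak : forall k k' b b', C1c s0 s1 k k' -> C1c t0 t1 b b' ->
  \int[mu]_(x in D) (f x * (k' (s x) * b (t x))) =
  - \int[mu]_(x in D) (g x * (k (s x) * b (t x))).

Lemma measurable_tensor (k b : R -> R) : measurable_fun setT k ->
  measurable_fun setT b -> measurable_fun D (fun x => k (s x) * b (t x)).
Proof.
move=> mk mb; apply: (measurable_funS measurableT) => //.
by apply: measurable_funM; apply: measurableT_comp.
Qed.

(** The weak formula is tested with [k n] in s times [b] in t. The side with [k' n] tends to the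
    difference of the two averages; the other side is, for every n, at most the integral of |g| over
    the larger interval, because |k n| <= 1 and [k n] vanishes outside ]a, c[. *)
Lemma average_diff_smooth a a' c c' b b' :
  s0 <= a -> a <= a' -> a' < c' -> c' <= c -> c <= s1 ->
  C1c t0 t1 b b' -> (forall y, 0 <= b y <= 1) ->
  `| (c' - a')^-1 * \int[mu]_(x in D) (f x * (\1_`]a', c'[ (s x) * b (t x)))
     - (c - a)^-1 * \int[mu]_(x in D) (f x * (\1_`]a, c[ (s x) * b (t x))) |
  <= \int[mu]_(x in D) (`|g x| * (\1_`]a, c[ (s x) * b (t x))).
Proof.
move=> s0a aa' ac' c'c cs1 bC b01.
have ac : a < c by rewrite (le_lt_trans aa')// (lt_le_trans ac').
have ca0 : 0 < c' - a' by rewrite subr_gt0.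
have ca0' : 0 < c - a by rewrite subr_gt0.
(* The factor 1/6 secures the hypothesis of [kern_bound] for the smaller interval, hence for both,
   from n = 0 on. *)
pose e n : R := (c' - a') / 6 * (n.+1%:R)^-1.
have e0 n : 0 < e n by rewrite /e mulr_gt0 ?divr_gt0 ?invr_gt0.
have e6 n : 6 * e n <= c' - a'.
  rewrite /e mulrA mulrCA divff// mulr1 ler_piMr ?(ltW ca0)//.
  by rewrite invf_le1// ler1n.
have e6' n : 6 * e n <= c - a by apply: le_trans (e6 n) _; lra.
have e_cvg : e @ \oo --> 0.
  rewrite -(mulr0 ((c' - a') / 6)); apply: cvgM; first exact: cvg_cst.
  exact: cvg_harmonic.
pose k n x := ikern a' c' (e n) x - ikern a c (e n) x.
pose k' n x := kern a' c' (e n) x - kern a c (e n) x.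
have kC n : C1c s0 s1 (k n) (k' n).
  have en := e0 n; have := e6 n; have := e6' n => h1 h2.
  split.
  - by move=> x; apply: is_deriveB; exact: is_derive_ikern.
  - by move=> x; apply: (continuousB (@continuous_kern _ _ _ _ x) (@continuous_kern _ _ _ _ x)).
  - exists (a + e n), (c - e n); split; [lra|lra|].
    move=> x; rewrite /k /k' => /negP; rewrite negb_and -!ltNge => /orP[xa|xc].
      have [||-> ->] := @ikern_lt _ a' c' (e n) x en; [lra|lra|].
      by have [||-> ->] := @ikern_lt _ a c (e n) x en; [lra|lra|rewrite !subrr].
    have [||-> ->] := @ikern_gt _ a' c' (e n) x en; [lra|lra|].
    by have [||-> ->] := @ikern_gt _ a c (e n) x en; [lra|lra|rewrite !subrr].
have k_le n x : `|k n x| <= \1_`]a, c[ x.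
  have en := e0 n; have := e6 n; have := e6' n => h1 h2.
  rewrite indicE; case: (boolP (x \in _)) => [_|xac].
    have h3 : 3 * e n < c' - a' by lra.
    have /andP[? ?] := ikern_itv x en h3.
    have h4 : 3 * e n < c - a by lra.
    have /andP[? ?] := ikern_itv x en h4.
    by rewrite mulr1n ler_norml; apply/andP; split; rewrite /k; lra.
  have [_ _ [a1 [c1 [h3 h4 h5]]]] := kC n.
  have [xa|xa] := leP x a.
    have [||E1 _] := @ikern_lt _ a' c' (e n) x en; [lra|lra|].
    have [||E2 _] := @ikern_lt _ a c (e n) x en; [lra|lra|].
    by rewrite /k E1 E2 subrr normr0.
  have [xc|xc] := leP c x.
    have [||E1 _] := @ikern_gt _ a' c' (e n) x en; [lra|lra|].
    have [||E2 _] := @ikern_gt _ a c (e n) x en; [lra|lra|].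
    by rewrite /k E1 E2 subrr normr0.
  by move: xac; rewrite notin_setE /= in_itv /= xa xc.
have k'_le n x : `|k' n x| <= 2 / (c' - a') + 2 / (c - a).
  apply: le_trans (ler_normB _ _) _.
  exact: lerD (kern_bound _ (e0 n) (e6 n)) (kern_bound _ (e0 n) (e6' n)).
have mb : measurable_fun setT b.
  apply: continuous_measurable_fun; exact: C1c_continuous bC.
have mk n : measurable_fun setT (k n).
  apply: continuous_measurable_fun; exact: C1c_continuous (kC n).
have mk' n : measurable_fun setT (k' n).
  by apply: continuous_measurable_fun; case: (kC n).
have bn y : `|b y| <= 1 by have /andP[b0 b1] := b01 y; rewrite ger0_norm.
have mi u v : measurable_fun setT (\1_`]u, v[ : R -> R) by exact: measurable_indic.
(* The pointwise limit of [k' n]. *)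
pose l x : R := \1_`]a', c'[ x / (c' - a') - \1_`]a, c[ x / (c - a).
have ml : measurable_fun setT l.
  by apply: measurable_funB; apply: measurable_funM.
have cvL : \int[mu]_(x in D) (f x * (k' n (s x) * b (t x))) @[n --> \oo] -->
    \int[mu]_(x in D) (f x * (l (s x) * b (t x))).
  apply: (cvg_Rintegral_bounded mD fi (B := 2 / (c' - a') + 2 / (c - a))).
  - by move=> n; exact: measurable_tensor.
  - exact: measurable_tensor.
  - move=> n x _; rewrite normrM; apply: le_trans (k'_le n (s x)).
    by rewrite ler_piMr.
  - move=> x _; apply: cvgM; last exact: cvg_cst.
    by apply: cvgB; exact: kern_cvg.
have iB u v : mu.-integrable D (EFin \o (fun x => `|g x| * (\1_`]u, v[ (s x) * b (t x)))).
  apply: (integrable_mul_bounded mD (B := 1)).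
  - exact: (integrable_norm gi).
  - exact: measurable_tensor.
  - move=> x _; rewrite normrM mulr_ile1// indicE.
    by case: (_ \in _); rewrite ?normr1 ?normr0.
have leL n : `|\int[mu]_(x in D) (f x * (k' n (s x) * b (t x)))| <=
    \int[mu]_(x in D) (`|g x| * (\1_`]a, c[ (s x) * b (t x))).
  rewrite (weak (kC n) bC) normrN.
  have gki : mu.-integrable D (EFin \o (fun x => g x * (k n (s x) * b (t x)))).
    apply: (integrable_mul_bounded mD (B := 1)) => //; first exact: measurable_tensor.
    move=> x _; rewrite normrM mulr_ile1//; apply: le_trans (k_le n (s x)) _.
    by rewrite indicE; case: (_ \in _).
  apply: le_trans (le_normr_Rintegral mD gki) _.
  apply: le_Rintegral => //; first exact: (integrable_norm gki).
  move=> x _; rewrite !normrM ler_wpM2l//; apply: ler_pM => //.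
  by have /andP[b0 _] := b01 (t x); rewrite ger0_norm.
have fki u v : mu.-integrable D (EFin \o (fun x => f x * (\1_`]u, v[ (s x) * b (t x)))).
  apply: (integrable_mul_bounded mD (B := 1)) => //.
  - exact: measurable_tensor.
  - move=> x _; rewrite normrM mulr_ile1// indicE.
    by case: (_ \in _); rewrite ?normr1 ?normr0.
rewrite -!RintegralZl// -RintegralB//; last 2 first.
- exact: (integrableZl mD _ (fki _ _)).
- exact: (integrableZl mD _ (fki _ _)).
rewrite (_ : Rintegral _ _ _ = \int[mu]_(x in D) (f x * (l (s x) * b (t x)))); last first.
  by apply: eq_Rintegral => x _; rewrite /l; ring.
apply: (cvgr_to_le (cvg_norm cvL)); apply: nearW => n; exact: leL.
Qed.

Lemma cvg_integral_cutoff h (p q u v : R) : mu.-integrable D (EFin \o h) ->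
  t0 <= u -> v <= t1 ->
  \int[mu]_(x in D) (h x * (\1_`]p, q[ (s x) * cutoff u v (n.+1%:R^-1) (t x)))
    @[n --> \oo] -->
  \int[mu]_(x in D) (h x * (\1_`]p, q[ (s x) * \1_`]u, v[ (t x))).
Proof.
move=> hi tu vt.
have e0 n : 0 < (n.+1%:R^-1 : R) by rewrite invr_gt0.
have mi a b : measurable_fun setT (\1_`]a, b[ : R -> R) by exact: measurable_indic.
apply: (cvg_Rintegral_bounded mD hi (B := 1)).
- move=> n; apply: measurable_tensor => //; apply: continuous_measurable_fun.
  by have [b' /C1c_continuous] := cutoff_C1c tu vt (e0 n).
- exact: measurable_tensor.
- move=> n x _; rewrite normrM mulr_ile1// ?indicE.
    by case: (_ \in _); rewrite ?normr1 ?normr0.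
  by rewrite ger0_norm ?cutoff_ge0 ?cutoff_le1.
- move=> x _; apply: cvgM; first exact: cvg_cst.
  by apply: cutoff_cvg => //; exact: cvg_harmonic.
Qed.

(** The smooth factor in t is a cutoff of ]u, v[ that increases to its indicator; all three
    integrals pass to the limit. *)
Lemma average_diff a a' c c' u v :
  s0 <= a -> a <= a' -> a' < c' -> c' <= c -> c <= s1 -> t0 <= u -> v <= t1 ->
  `| (c' - a')^-1 * \int[mu]_(x in D) (f x * (\1_`]a', c'[ (s x) * \1_`]u, v[ (t x)))
     - (c - a)^-1 * \int[mu]_(x in D) (f x * (\1_`]a, c[ (s x) * \1_`]u, v[ (t x))) |
  <= \int[mu]_(x in D) (`|g x| * (\1_`]a, c[ (s x) * \1_`]u, v[ (t x))).
Proof.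
move=> s0a aa' ac' c'c cs1 tu vt.
have cv r p q : r * \int[mu]_(x in D) (f x * (\1_`]p, q[ (s x) * cutoff u v n.+1%:R^-1 (t x)))
    @[n --> \oo] --> r * \int[mu]_(x in D) (f x * (\1_`]p, q[ (s x) * \1_`]u, v[ (t x))).
  by apply: cvgM; [exact: cvg_cst|exact: cvg_integral_cutoff].
apply: (ler_cvg_to (a := \oo) (cvg_norm (cvgB (cv _ _ _) (cv _ _ _)))
  (cvg_integral_cutoff (integrable_norm gi) tu vt)).
apply: nearW => n; have e0 : 0 < (n.+1%:R^-1 : R) by rewrite invr_gt0.
have [b' bC] := cutoff_C1c tu vt e0.
apply: (average_diff_smooth s0a aa' ac' c'c cs1 bC) => y.
by rewrite cutoff_ge0 ?cutoff_le1.
Qed.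

(** The average over ]s0, s0 + h[ tends to 0 by the trace hypothesis and differs from the one over
    ]s0, s1[ by at most the integral of |g|. The limit h -> 0 precedes the limit of the cutoffs,
    since the trace is tested against a fixed C^1 function. *)
Lemma average_trace u v : s0 < s1 -> t0 <= u -> v <= t1 ->
  (forall b b', C1c t0 t1 b b' ->
    h^-1 * \int[mu]_(x in D) (f x * (\1_`]s0, s0 + h[ (s x) * b (t x)))
      @[h --> 0^'+] --> 0) ->
  `| (s1 - s0)^-1 * \int[mu]_(x in D) (f x * (\1_`]s0, s1[ (s x) * \1_`]u, v[ (t x))) |
  <= \int[mu]_(x in D) (`|g x| * (\1_`]s0, s1[ (s x) * \1_`]u, v[ (t x))).
Proof.
move=> s01 tu vt tr.
have cv r p q : r * \int[mu]_(x in D) (f x * (\1_`]p, q[ (s x) * cutoff u v n.+1%:R^-1 (t x)))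
    @[n --> \oo] --> r * \int[mu]_(x in D) (f x * (\1_`]p, q[ (s x) * \1_`]u, v[ (t x))).
  by apply: cvgM; [exact: cvg_cst|exact: cvg_integral_cutoff].
apply: (ler_cvg_to (a := \oo) (cvg_norm (cv _ _ _))
  (cvg_integral_cutoff (integrable_norm gi) tu vt)).
apply: nearW => n; have e0 : 0 < (n.+1%:R^-1 : R) by rewrite invr_gt0.
have [b' bC] := cutoff_C1c tu vt e0.
have b01 y : 0 <= cutoff u v n.+1%:R^-1 y <= 1 by rewrite cutoff_ge0 ?cutoff_le1.
set I := \int[mu]_(x in D) _; set J := \int[mu]_(x in D) _.
have : `|0 - (s1 - s0)^-1 * I| <= J.
  apply: (cvgr_to_le (cvg_norm (cvgB (tr _ _ bC) (cvg_cst ((s1 - s0)^-1 * I))))).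
  near=> h; have h0 : 0 < h by near: h; exact: nbhs_right_gt.
  have hs : h <= s1 - s0 by near: h; apply: nbhs_right_le; rewrite subr_gt0.
  have := @average_diff_smooth s0 s0 s1 (s0 + h) _ b' (lexx _) (lexx _).
  move=> /(_ (cutoff u v n.+1%:R^-1)); rewrite ltrDl addrAC subrr add0r.
  by apply => //; rewrite -lerBrDl.
by rewrite sub0r normrN.
Unshelve. all: by end_near. Qed.

End averages.

(** * Averages over rectangles in Omega *)

Section rectangles.
Variable R : realType.
Local Notation leb2 := (@lebesgue_measure R \x @lebesgue_measure R)%E.
Local Notation plane := (measurableTypeR R * measurableTypeR R)%type.
Implicit Types (f g : R * R -> R).

Definition rect (a c b d : R) : set (R * R) := `]a, c[ `*` `]b, d[.

Lemma measurable_rect a c b d : measurable (rect a c b d : set plane).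
Proof. by apply: measurableX; exact: measurable_itv. Qed.

Lemma measurable_Omega (th0 R0 : R) : measurable (Omega th0 R0 : set plane).
Proof. by apply: measurableX; exact: measurable_itv. Qed.

Lemma measurable_OmegaM (th0 R0 M : R) :
  measurable (Omega th0 R0 `&` [set x | x.2 <= M] : set plane).
Proof.
apply: measurableI; first exact: measurable_Omega.
rewrite (_ : [set _ | _] = setT `*` `]-oo, M]).
  by apply: measurableX => //; exact: measurable_itv.
apply/seteqP; split => x /=; rewrite in_itv /=; first by [].
by case.
Qed.

Lemma indic_rect a c b d (x : R * R) :
  (\1_`]a, c[ x.1 * \1_`]b, d[ x.2 : R) = \1_(rect a c b d) x.
Proof.
rewrite !indicE -natrM mulnb; congr (nat_of_bool _)%:R.
by apply/andP/idP => [[]|]; rewrite !inE.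
Qed.

Lemma Rintegral_indic (D E : set (R * R)) f : E `<=` D ->
  \int[leb2]_(x in D) (f x * \1_E x) = \int[leb2]_(x in E) f x.
Proof.
move=> ED; rewrite -[in RHS](setIidr ED) Rintegral_mkcondr.
by apply: eq_Rintegral => x _; rewrite patchE indicE; case: (_ \in _);
  rewrite ?mulr1 ?mulr0.
Qed.

Lemma Rintegral_shrink (D E : set (R * R)) f : E `<=` D ->
  (forall x, D x -> ~ E x -> f x = 0) ->
  \int[leb2]_(x in D) f x = \int[leb2]_(x in E) f x.
Proof.
move=> ED f0; rewrite -[in RHS](setIidr ED) Rintegral_mkcondr.
apply: eq_Rintegral => x; rewrite inE => Dx; rewrite patchE.
case: (boolP (x \in E)) => //; rewrite notin_setE => nE; exact: f0.
Qed.

Variables (th0 R0 : R).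
Hypothesis th0_gt0 : 0 < th0.
Local Notation OmegaM M := (Omega th0 R0 `&` [set x | x.2 <= M]).

Lemma rect_sub_OmegaM a c b d M : 0 <= a -> c <= th0 -> R0 <= b -> d <= M ->
  rect a c b d `<=` OmegaM M.
Proof.
move=> a0 cth bR dM x [] /=; rewrite !in_itv /= => /andP[ax xc] /andP[bx xd].
split; first split; rewrite /= ?in_itv /= ?andbT.
- by rewrite (le_lt_trans a0 ax) (lt_le_trans xc cth).
- exact: le_lt_trans bx.
- exact: le_trans (ltW xd) dM.
Qed.

(** The weak formula lives on the unbounded Omega, where f and g need not be integrable; b vanishes
    from M on, so both integrals reduce to the part R <= M. *)
Lemma weak_dw_tensor f g M k k' b b' : weak_dw th0 R0 f g ->
  C1c 0 th0 k k' -> C1c R0 M b b' ->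
  \int[leb2]_(x in OmegaM M) (f x * (k' x.1 * b x.2)) =
  - \int[leb2]_(x in OmegaM M) (g x * (k x.1 * b x.2)).
Proof.
move=> [_ _ W] kC bC.
have [tf D1 _] := test_fun_tensor kC bC.
have := W _ tf; under eq_Rintegral do rewrite D1.
have [_ _ [a1 [c1 [_ c1M b0]]]] := bC.
have b0' x : Omega th0 R0 x -> ~ OmegaM M x -> b x.2 = 0.
  move=> Ox nx; apply: (b0 _ _).1 => /andP[_ xc]; apply: nx; split => //=.
  exact: le_trans xc (ltW c1M).
rewrite (Rintegral_shrink (E := OmegaM M)) //; last first.
  by move=> x Ox nx; rewrite b0' ?mulr0.
rewrite [in X in _ = X -> _](Rintegral_shrink (E := OmegaM M)) //.
by move=> x Ox nx; rewrite b0' ?mulr0.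
Qed.

Lemma weak_dR_tensor f g M k k' b b' : weak_dR th0 R0 f g ->
  C1c R0 M k k' -> C1c 0 th0 b b' ->
  \int[leb2]_(x in OmegaM M) (f x * (k' x.2 * b x.1)) =
  - \int[leb2]_(x in OmegaM M) (g x * (k x.2 * b x.1)).
Proof.
move=> [_ _ W] kC bC.
have [tf _ D2] := test_fun_tensor bC kC.
have := W _ tf; under eq_Rintegral do rewrite D2 mulrC.
under [in X in _ = X -> _]eq_Rintegral do rewrite [b _ * _]mulrC.
have [_ _ [a1 [c1 [_ c1M b0]]]] := kC.
have b0' x : Omega th0 R0 x -> ~ OmegaM M x -> k x.2 = 0 /\ k' x.2 = 0.
  move=> Ox nx; apply: (b0 _ _) => /andP[_ xc]; apply: nx; split => //=.
  exact: le_trans xc (ltW c1M).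
rewrite (Rintegral_shrink (E := OmegaM M)) //; last first.
  by move=> x Ox nx; rewrite (b0' _ _ _).2 ?(mulr0,mul0r).
rewrite [in X in _ = X -> _](Rintegral_shrink (E := OmegaM M)) //.
  by under [in X in X = _ -> _]eq_Rintegral do rewrite [b _ * _]mulrC mulrC.
by move=> x Ox nx; rewrite (b0' _ _ _).1 ?(mulr0,mul0r).
Qed.

Lemma average_diff_w f g a a' c c' b d : weak_dw th0 R0 f g ->
  0 <= a -> a <= a' -> a' < c' -> c' <= c -> c <= th0 -> R0 <= b ->
  `| (c' - a')^-1 * \int[leb2]_(x in rect a' c' b d) f x
     - (c - a)^-1 * \int[leb2]_(x in rect a c b d) f x |
  <= \int[leb2]_(x in rect a c b d) `|g x|.
Proof.
move=> W a0 aa' ac' c'c cth bR.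
have [fi gi _] := W.
have := @average_diff _ _ _ leb2 _ (measurable_OmegaM th0 R0 d)
  fst snd (@measurable_fst _ _ _ _) (@measurable_snd _ _ _ _) 0 th0 R0 d f g
  (fi d) (gi d) (fun k k' b b' => weak_dw_tensor W)
  a a' c c' b d a0 aa' ac' c'c cth bR (lexx d).
under eq_Rintegral do rewrite indic_rect.
under [in X in _ - X]eq_Rintegral do rewrite indic_rect.
under [in X in _ <= X]eq_Rintegral do rewrite indic_rect.
by rewrite !Rintegral_indic//; apply: rect_sub_OmegaM => //;
  [exact: le_trans aa'|exact: le_trans cth].
Qed.

Lemma average_diff_R f g a c b b' d d' : weak_dR th0 R0 f g ->
  0 <= a -> c <= th0 -> R0 <= b -> b <= b' -> b' < d' -> d' <= d ->
  `| (d' - b')^-1 * \int[leb2]_(x in rect a c b' d') f x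
     - (d - b)^-1 * \int[leb2]_(x in rect a c b d) f x |
  <= \int[leb2]_(x in rect a c b d) `|g x|.
Proof.
move=> W a0 cth bR bb' bd' d'd.
have [fi gi _] := W.
have := @average_diff _ _ _ leb2 _ (measurable_OmegaM th0 R0 d)
  snd fst (@measurable_snd _ _ _ _) (@measurable_fst _ _ _ _) R0 d 0 th0 f g
  (fi d) (gi d) (fun k k' b b' => weak_dR_tensor W)
  b b' d d' a c bR bb' bd' d'd (lexx d) a0 cth.
under eq_Rintegral do rewrite [\1__ _ * _]mulrC indic_rect.
under [in X in _ - X]eq_Rintegral do rewrite [\1__ _ * _]mulrC indic_rect.
under [in X in _ <= X]eq_Rintegral do rewrite [\1__ _ * _]mulrC indic_rect.
by rewrite !Rintegral_indic//; apply: rect_sub_OmegaM => //; exact: le_trans bb'.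
Qed.

Lemma average_trace_w f g b d : weak_dw th0 R0 f g -> zero_at_w0 th0 R0 f ->
  R0 <= b ->
  `| th0^-1 * \int[leb2]_(x in rect 0 th0 b d) f x |
  <= \int[leb2]_(x in rect 0 th0 b d) `|g x|.
Proof.
move=> W Z bR.
have [fi gi _] := W.
have := @average_trace _ _ _ leb2 _ (measurable_OmegaM th0 R0 d)
  fst snd (@measurable_fst _ _ _ _) (@measurable_snd _ _ _ _) 0 th0 R0 d f g
  (fi d) (gi d) (fun k k' b b' => weak_dw_tensor W) b d th0_gt0 bR (lexx d).
under eq_Rintegral do rewrite indic_rect.
under [in X in _ <= X]eq_Rintegral do rewrite indic_rect.
rewrite subr0 !Rintegral_indic//; try exact: rect_sub_OmegaM.
apply => k k' kC.
have [_ _ [a1 [c1 [a1R c1M k0]]]] := kC.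
have := Z k (C1c_continuous kC).
have H : exists K : set R, [/\ compact K, K `<=` `]R0, +oo[ & forall s, ~ K s -> k s = 0].
  exists `[a1, c1]%classic; split.
  - exact: segment_compact.
  - by move=> x /=; rewrite !in_itv /= andbT => /andP[h _]; exact: lt_le_trans h.
  - by move=> x /=; rewrite in_itv /= => /k0[].
(* For 0 < h <= th0 the strip of the trace condition and the truncated domain both reduce to ]0,
   h[ x ]R0, d[, as k is supported in ]R0, d[. *)
move=> /(_ H); apply: cvg_trans; apply: near_eq_cvg; near=> h.
congr (_ * _).
have h0 : 0 < h by near: h; exact: nbhs_right_gt.
have hs : h <= th0 by near: h; exact: nbhs_right_le.
rewrite (Rintegral_shrink (E := rect 0 h R0 d)); last 2 first.
- move=> x [] /=; rewrite !in_itv /= => /andP[x0 xh] /andP[xR xd].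
  split => //; split; rewrite /= in_itv /= ?andbT//.
  by rewrite x0 (lt_le_trans xh hs).
- move=> x [[]] /=; rewrite !in_itv /= andbT => /andP[x0 _] xR xh nx.
  rewrite (k0 _ _).1 ?mulr0// => /andP[_ xc]; apply: nx.
  by split; rewrite /= in_itv /= ?x0 ?xR//=; exact: le_lt_trans c1M.
rewrite [RHS](Rintegral_shrink (E := rect 0 h R0 d)).
- apply: eq_Rintegral => x; rewrite inE => -[] /= x1 _.
  by rewrite add0r indicE mem_set// mul1r.
- exact: rect_sub_OmegaM.
- move=> x [[]] /=; rewrite !in_itv /= andbT => /andP[x0 _] xR xd nx.
  rewrite add0r indicE; case: (boolP (_ \in _)); rewrite ?mul0r ?mulr0//.
  rewrite inE /= in_itv /= => /andP[_ xh].
  rewrite (k0 _ _).1 ?mulr0// => /andP[_ xc]; apply: nx.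
  by split; rewrite /= in_itv /= ?x0 ?xR//=; exact: le_lt_trans c1M.
Unshelve. all: by end_near. Qed.

End rectangles.

(** * Morrey's argument *)

(** Lengthening an interval must not leave the box: the longer one starts at a, or further left when
    it would overrun the right end. *)
Lemma enlarge_itv (R : realType) (x0 l L a c : R) :
  x0 <= a -> a <= c -> c <= x0 + l -> L <= l -> c - a <= L ->
  exists a1, [/\ x0 <= a1, a1 <= a, c <= a1 + L & a1 + L <= x0 + l].
Proof.
move=> xa ac cx Ll caL; exists (Num.min a (x0 + l - L)).
have [h|h] := leP a (x0 + l - L); split; lra.
Qed.

Lemma exists_half_exp_le (R : realType) (x : R) : 0 < x ->
  exists n, forall m, (n <= m)%N -> 2^-1 ^+ m <= x.
Proof.
move=> x0; have /cvgrPdist_le /(_ x x0) [n _ H] : (2^-1 ^+ n : R) @[n --> \oo] --> 0.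
  by apply: cvg_expr; rewrite ger0_norm ?invf_lt1 ?ltr1n.
by exists n => m nm; have := H m nm; rewrite /= sub0r normrN ger0_norm ?exprn_ge0.
Qed.

(** A side 2^-n against the area 4^-n to the power -s gives 2^(-(1 - 2 s) n). The additional halving
    of one side costs 2^s <= 2. *)
Lemma half_scale_powR (R : realType) (s : R) n : 0 < s < 2^-1 ->
  2^-1 ^+ n * (2^-1 ^+ n * 2^-1 ^+ n.+1) `^ (- s) <= 2 * (2^-1 `^ (1 - 2 * s)) ^+ n.
Proof.
move=> /andP[s0 s1].
have h0 : (0 : R) <= 2^-1 by rewrite invr_ge0.
have e0 k : (0 : R) <= 2^-1 ^+ k by rewrite exprn_ge0.
have he : (2^-1 `^ (1 - 2 * s)) ^+ n = 2^-1 ^+ n * ((2^-1 ^+ n * 2^-1 ^+ n) `^ (- s)).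
  elim: n => [|n IH]; first by rewrite !expr0 !mulr1 powR1 mulr1.
  rewrite exprS IH exprS.
  have -> : 2^-1 * 2^-1 ^+ n * (2^-1 * 2^-1 ^+ n) = (2^-1 * 2^-1) * (2^-1 ^+ n * 2^-1 ^+ n) :> R by ring.
  rewrite [in RHS]powRM ?mulr_ge0//.
  have hn (r : R) : (r == 0) ==> ((2^-1 : R) != 0).
    by apply/implyP => _; rewrite gt_eqF// invr_gt0.
  have -> : (2^-1 : R) `^ (1 - 2 * s) = 2^-1 * (2^-1 * 2^-1) `^ (- s).
    rewrite -[in X in _ = X * _](powRr1 h0) powRM// -!powRD//.
    by congr (_ `^ _); ring.
  by ring.
rewrite he.
have -> : (2^-1 ^+ n * 2^-1 ^+ n.+1) `^ (- s) =
    (2^-1 ^+ n * 2^-1 ^+ n) `^ (- s) * (2^-1 : R) `^ (- s).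
  by rewrite -powRM ?mulr_ge0// exprS; congr (_ `^ _); ring.
rewrite mulrA mulrC ler_wpM2r ?mulr_ge0 ?powR_ge0//.
apply: (@le_trans _ _ (2^-1 `^ (-1))); last by rewrite powR_inv1// invrK.
by apply: ger_powR; [apply/andP; split|]; lra.
Qed.

(* m stands for the average of f over ]a, c[ x ]b, d[, and G, H for the integrals of its
   derivatives. *)
Section chain.
Variables (R : realType) (th T b0 s A B : R).
Hypotheses (th0 : 0 < th) (T0 : 0 < T) (hs : 0 < s < 2^-1) (A0 : 0 <= A) (B0 : 0 <= B).
Variables m G H : R -> R -> R -> R -> R.

Hypothesis Gle : forall a c b d, 0 <= a -> a < c -> c <= th ->
  b0 <= b -> b < d -> d <= b0 + T ->
  G a c b d <= 2 * A * ((c - a) * (d - b)) * ((c - a) * (d - b)) `^ (- s).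
Hypothesis Hle : forall a c b d, 0 <= a -> a < c -> c <= th ->
  b0 <= b -> b < d -> d <= b0 + T ->
  H a c b d <= 2 * B * ((c - a) * (d - b)) * ((c - a) * (d - b)) `^ (- s).
Hypothesis mG : forall a a' c c' b d, 0 <= a -> a <= a' -> a' < c' -> c' <= c ->
  c <= th -> b0 <= b -> b < d -> d <= b0 + T ->
  `|m a' c' b d - m a c b d| <= (d - b)^-1 * G a c b d.
Hypothesis mH : forall a c b b' d d', 0 <= a -> a < c -> c <= th -> b0 <= b ->
  b <= b' -> b' < d' -> d' <= d -> d <= b0 + T ->
  `|m a c b' d' - m a c b d| <= (c - a)^-1 * H a c b d.
Hypothesis m0 : forall b d, b0 <= b -> b < d -> d <= b0 + T ->
  `|m 0 th b d| <= (d - b)^-1 * G 0 th b d.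

(** [K * rho ^+ n] will bound the change of the average between the scales n + 1 and n. The 4 in [K]
    is the 2 of [Gle] and [Hle] times the 2 of [half_scale_powR]. *)
Let rho := (2^-1 : R) `^ (1 - 2 * s).
Let K := 4 * (A * th + B * T) * (th * T) `^ (- s).

Let h0 : (0 : R) <= 2^-1. Proof. by rewrite invr_ge0. Qed.
Let hn0 n : (0 : R) < 2^-1 ^+ n. Proof. by rewrite exprn_gt0// invr_gt0. Qed.
Let hn1 n : (2^-1 : R) ^+ n <= 1.
Proof. by rewrite exprn_ile1// invf_le1// ler1n. Qed.

(** The exponent -s is negative, so a lower bound on the area L W suffices. *)
Lemma scale_step n L W : 0 <= L -> 0 <= W ->
  th * T * (2^-1 ^+ n * 2^-1 ^+ n.+1) <= L * W ->
  2^-1 ^+ n * (L * W) `^ (- s) <= 2 * (th * T) `^ (- s) * rho ^+ n.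
Proof.
move=> L0 W0 LW.
have e0 k : (0 : R) <= 2^-1 ^+ k by rewrite exprn_ge0.
apply: (@le_trans _ _ (2^-1 ^+ n * (th * T * (2^-1 ^+ n * 2^-1 ^+ n.+1)) `^ (- s))).
  have h1 : 0 < th * T * (2^-1 ^+ n * 2^-1 ^+ n.+1).
    by apply: mulr_gt0; apply: mulr_gt0.
  have h2 := lt_le_trans h1 LW.
  rewrite ler_wpM2l// !powRN lef_pV2 ?posrE ?powR_gt0//.
  rewrite ge0_ler_powR ?nnegrE ?(ltW h1) ?(ltW h2)//.
  by case/andP: hs => /ltW.
rewrite powRM ?mulr_ge0 ?(ltW th0) ?(ltW T0)// mulrCA.
rewrite [leRHS](_ : _ = (th * T) `^ (- s) * (2 * rho ^+ n)); last by ring.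
by rewrite ler_wpM2l ?powR_ge0// half_scale_powR.
Qed.

Lemma rho_lt1 : 0 < rho < 1.
Proof.
rewrite /rho powR_gt0 ?invr_gt0//=.
have /andP[s0 s1] := hs.
suff : rho < 1 `^ (1 - 2 * s) by rewrite powR1.
by apply: gt0_ltr_powR; rewrite ?nnegrE ?invf_lt1 ?ltr1n//; lra.
Qed.

(** The partial sum 1 + rho + ... + rho^(n-1) in closed form; the extra 1 pays for the average over
    the full box. *)
Let scale_bound n := K * (1 + (1 - rho ^+ n) / (1 - rho)).

Lemma scale_bound_succ n : scale_bound n.+1 = scale_bound n + K * rho ^+ n.
Proof.
rewrite /scale_bound exprS; have /andP[_ r1] := rho_lt1.
by field; rewrite subr_eq0 gt_eqF.
Qed.

Let P0 : 0 <= (th * T) `^ (- s). Proof. exact: powR_ge0. Qed.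

(** [mG] compares averages that differ in omega only, so the sides are enlarged one after the other:
    the omega side grows to th 2^-n, if shorter, while the other may still be at scale n + 1. Hence
    the mixed exponents n and n + 1 in [scale_step]. *)
Lemma mean_step_w n a c b d : 0 <= a -> a < c -> c <= th ->
  b0 <= b -> b < d -> d <= b0 + T ->
  th * 2^-1 ^+ n.+1 <= c - a -> T * 2^-1 ^+ n.+1 <= d - b ->
  exists a1 c1, [/\ 0 <= a1, a1 < c1, c1 <= th, th * 2^-1 ^+ n <= c1 - a1 &
    `|m a c b d - m a1 c1 b d| <= 4 * (A * th) * (th * T) `^ (- s) * rho ^+ n].
Proof.
move=> a0 ac cth bb bd dT Lge Wge.
have /andP[rho0 _] := rho_lt1.
have [thL|Lth] := leP (th * 2^-1 ^+ n) (c - a).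
  exists a, c; split => //; rewrite subrr normr0.
  by rewrite !mulr_ge0 ?exprn_ge0 ?(ltW th0) ?(ltW rho0).
have thn : th * 2^-1 ^+ n <= th by rewrite ler_piMr ?(ltW th0).
have cth0 : c <= 0 + th by rewrite add0r.
have [a1 [a10 a1a ca1 a1th]] := enlarge_itv a0 (ltW ac) cth0 thn (ltW Lth).
rewrite add0r in a1th.
set L := th * 2^-1 ^+ n in thn Lth ca1 a1th *.
have L0 : 0 < L by rewrite mulr_gt0.
have W0 : 0 < d - b by rewrite subr_gt0.
exists a1, (a1 + L); rewrite addrAC subrr add0r ltrDl; split => //.
apply: (le_trans (mG a10 a1a ac ca1 a1th bb bd dT)).
have a1L : a1 < a1 + L by rewrite ltrDl.
have := Gle a10 a1L a1th bb bd dT; rewrite addrAC subrr add0r => GG.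
rewrite ler_pdivrMl//; apply: (le_trans GG).
have := @scale_step n L (d - b) (ltW L0) (ltW W0).
have h : th * T * (2^-1 ^+ n * 2^-1 ^+ n.+1) <= L * (d - b).
  rewrite [leLHS](_ : _ = L * (T * 2^-1 ^+ n.+1)); last by rewrite /L; ring.
  by rewrite ler_wpM2l ?(ltW L0).
move=> /(_ h) S.
have AW : 0 <= 2 * A * th * (d - b) by rewrite !mulr_ge0 ?(ltW th0) ?(ltW W0).
have := ler_wpM2l AW S.
by congr (_ <= _); rewrite /L; ring.
Qed.

Lemma mean_step_R n a c b d : 0 <= a -> a < c -> c <= th ->
  b0 <= b -> b < d -> d <= b0 + T ->
  th * 2^-1 ^+ n.+1 <= c - a -> T * 2^-1 ^+ n.+1 <= d - b ->
  exists b1 d1, [/\ b0 <= b1, b1 < d1, d1 <= b0 + T, T * 2^-1 ^+ n <= d1 - b1 &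
    `|m a c b d - m a c b1 d1| <= 4 * (B * T) * (th * T) `^ (- s) * rho ^+ n].
Proof.
move=> a0 ac cth bb bd dT Lge Wge.
have /andP[rho0 _] := rho_lt1.
have [TW|WT] := leP (T * 2^-1 ^+ n) (d - b).
  exists b, d; split => //; rewrite subrr normr0.
  by rewrite !mulr_ge0 ?exprn_ge0 ?(ltW T0) ?(ltW rho0).
have Tn : T * 2^-1 ^+ n <= T by rewrite ler_piMr ?(ltW T0).
have [b1 [b10 b1b db1 b1T]] := @enlarge_itv _ b0 T _ b d bb (ltW bd) dT Tn (ltW WT).
set W := T * 2^-1 ^+ n in Tn WT db1 b1T *.
have W0 : 0 < W by rewrite mulr_gt0.
have L0 : 0 < c - a by rewrite subr_gt0.
exists b1, (b1 + W); rewrite addrAC subrr add0r ltrDl; split => //.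
apply: (le_trans (mH a0 ac cth b10 b1b bd db1 b1T)).
have b1W : b1 < b1 + W by rewrite ltrDl.
have := Hle a0 ac cth b10 b1W b1T; rewrite [X in X - b1]addrC addrK => HH.
rewrite ler_pdivrMl//; apply: (le_trans HH).
have := @scale_step n (c - a) W (ltW L0) (ltW W0).
have h : th * T * (2^-1 ^+ n * 2^-1 ^+ n.+1) <= (c - a) * W.
  rewrite [leLHS](_ : _ = (th * 2^-1 ^+ n.+1) * W); last by rewrite /W; ring.
  by rewrite ler_wpM2r ?(ltW W0).
move=> /(_ h) S.
have BL : 0 <= 2 * B * T * (c - a) by rewrite !mulr_ge0 ?(ltW T0) ?(ltW L0).
have := ler_wpM2l BL S.
by congr (_ <= _); rewrite /W; ring.
Qed.

Lemma mean_bound_scale n a c b d : 0 <= a -> a < c -> c <= th ->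
  b0 <= b -> b < d -> d <= b0 + T ->
  th * 2^-1 ^+ n <= c - a -> T * 2^-1 ^+ n <= d - b -> `|m a c b d| <= scale_bound n.
Proof.
elim: n a c b d => [|n IH] a c b d a0 ac cth bb bd dT.
  rewrite !expr0 !mulr1 => tha Tb.
  (* At scale 0 the lower bounds on the sides leave only the full box, where [m0] applies. *)
  have -> : a = 0 by lra.
  have -> : c = th by lra.
  have -> : b = b0 by lra.
  have -> : d = b0 + T by lra.
  have lt1 : b0 < b0 + T by rewrite ltrDl.
  apply: (le_trans (m0 (lexx _) lt1 (lexx _))).
  have := Gle (lexx 0) th0 (lexx th) (lexx b0) lt1 (lexx _).
  rewrite !subr0 addrAC subrr add0r => GG.
  rewrite /scale_bound expr0 subrr mul0r addr0 mulr1 /K.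
  rewrite ler_pdivrMl//; apply: (le_trans GG).
  rewrite [leRHS](_ : _ = 2 * A * (th * T) * (th * T) `^ (- s) +
    (2 * A * (th * T) * (th * T) `^ (- s) + 4 * B * (T * T) * (th * T) `^ (- s))); last by ring.
  rewrite lerDl addr_ge0 ?mulr_ge0//; exact: ltW.
move=> Lge Wge.
have [a1 [c1 [a10 ac1 c1th L1 d1]]] := mean_step_w a0 ac cth bb bd dT Lge Wge.
have le1 : th * 2^-1 ^+ n.+1 <= c1 - a1.
  apply: le_trans L1; rewrite ler_wpM2l ?(ltW th0)//.
  by rewrite exprS ler_piMl ?ltW ?invf_lt1 ?ltr1n.
have [b1 [e1 [b10 bd1 d1T W1 d2]]] := mean_step_R a10 ac1 c1th bb bd dT le1 Wge.
have I := IH _ _ _ _ a10 ac1 c1th b10 bd1 d1T L1 W1.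
rewrite scale_bound_succ /K.
rewrite [X in `|X|](_ : _ = m a1 c1 b1 e1 +
  ((m a c b d - m a1 c1 b d) + (m a1 c1 b d - m a1 c1 b1 e1))); last by ring.
apply: (le_trans (ler_normD _ _)); apply: lerD; first exact: I.
apply: (le_trans (ler_normD _ _)).
rewrite [leRHS](_ : _ = 4 * (A * th) * (th * T) `^ (- s) * rho ^+ n +
  4 * (B * T) * (th * T) `^ (- s) * rho ^+ n); last by ring.
exact: lerD.
Qed.

(** The scale n is chosen from the relatively shorter side, and the bound does not depend on n.
    Arbitrary aspect ratios are thus covered, which lets the two variables be differentiated
    separately later on. *)
Lemma mean_bound a c b d : 0 <= a -> a < c -> c <= th ->
  b0 <= b -> b < d -> d <= b0 + T ->
  `|m a c b d| <= 4 * (1 + (1 - 2^-1 `^ (1 - 2 * s))^-1) * (A * th + B * T) *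
     (th * T) `^ (- s).
Proof.
move=> a0 ac cth bb bd dT.
have [|n1 H1] := @exists_half_exp_le R ((c - a) / th).
  by rewrite divr_gt0 ?subr_gt0.
have [|n2 H2] := @exists_half_exp_le R ((d - b) / T).
  by rewrite divr_gt0 ?subr_gt0.
pose n := maxn n1 n2.
have := @mean_bound_scale n a c b d a0 ac cth bb bd dT.
rewrite mulrC -ler_pdivlMr// H1 ?leq_maxl// => /(_ isT).
rewrite mulrC -ler_pdivlMr// H2 ?leq_maxr// => /(_ isT).
move=> /le_trans; apply.
have K0 : 0 <= K by rewrite /K !mulr_ge0 ?addr_ge0 ?mulr_ge0 ?(ltW th0) ?(ltW T0).
have /andP[r0 r1] := rho_lt1.
rewrite [leRHS](_ : _ = K * (1 + (1 - rho)^-1)); last by rewrite /K /rho; ring.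
rewrite /scale_bound ler_wpM2l// lerD2l ler_piMl ?invr_ge0 ?subr_ge0 ?(ltW r1)//.
by rewrite gerBl exprn_ge0// ltW.
Qed.

End chain.

(** * From averages to almost everywhere bounds *)

Lemma ae_forall_countType d (T : measurableType d) (R : realType)
    (mu : {measure set T -> \bar R}) (I : countType) (P : I -> T -> Prop) :
  (forall i, {ae mu, forall x, P i x}) -> {ae mu, forall x, forall i, P i x}.
Proof.
move=> H.
have : {ae mu, forall x, forall n : nat, forall i, unpickle n = Some i -> P i x}.
  apply: ae_foralln => n; case: (@unpickle I n) => [i|]; last exact: aeW.
  by apply: (@filterS _ _ (ae_filter_ringOfSetsType mu) _ _ _ (H i)) => x Px j [<-].
apply: (@filterS _ _ (ae_filter_ringOfSetsType mu)) => x Hx i.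
by apply: (Hx (pickle i)); rewrite pickleK.
Qed.

Section lebesgue_points.
Variable R : realType.
Local Notation mu := (@lebesgue_measure R).
Local Notation leb2 := (@lebesgue_measure R \x @lebesgue_measure R)%E.

(** Lebesgue differentiation is run along a countable family of intervals, so that the exceptional
    null sets of all of them can be united. *)
Definition grid (n : nat) (k : int) : set R := `]k%:~R / n.+1%:R, (k + 1)%:~R / n.+1%:R[%classic.

Lemma grid_measure n k : mu (grid n k) = (n.+1%:R^-1)%:E.
Proof.
rewrite /grid lebesgue_measure_itv /= lte_fin ltr_pM2r ?invr_gt0// ltr_int ltrDl ltr01.
by rewrite -EFinB -mulrBl intrD addrAC subrr add0r mul1r.
Qed.

Lemma floor_grid (x : R) n (k := Num.floor (x * n.+1%:R)) :
  k%:~R / n.+1%:R <= x < (k + 1)%:~R / n.+1%:R.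
Proof. by rewrite ler_pdivrMr// ltr_pdivlMr// floor_itv. Qed.

Lemma floor_grid_near (x y : R) n : let k := Num.floor (x * n.+1%:R) in
  k%:~R / n.+1%:R <= y <= (k + 1)%:~R / n.+1%:R -> `|x - y| <= n.+1%:R^-1.
Proof.
move=> k /andP[ky yk]; have /andP[kx xk] := floor_grid x n.
have E : (k + 1)%:~R / n.+1%:R = k%:~R / n.+1%:R + n.+1%:R^-1 :> R.
  by rewrite intrD mulrDl mul1r.
rewrite -/k in kx xk; rewrite E in yk xk.
have gen (a e : R) : a <= x -> x < a + e -> a <= y -> y <= a + e -> `|x - y| <= e.
  by move=> *; rewrite ler_norml; apply/andP; split; lra.
exact: gen kx xk ky yk.
Qed.

Lemma grid_nicely_shrinking (x : R) :
  nicely_shrinking x (fun n => grid n (Num.floor (x * n.+1%:R))).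
Proof.
split; first by move=> n; exact: measurable_itv.
have e0 n : 0 < (n.+1%:R^-1 : R) by rewrite invr_gt0.
(* The ball of radius 2/(n + 1) around x contains the cell and has measure 4/(n + 1), four times
   that of the cell. The point x may be the excluded left end of its cell, which the notion
   permits. *)
exists (4, fun n => PosNum (mulr_gt0 (ltr0n R 2) (e0 n))); split => //=.
- rewrite -(mulr0 2); apply: cvgM; first exact: cvg_cst.
  exact: cvg_harmonic.
- move=> n y; rewrite /grid /= in_itv /= => /andP[ky yk].
  rewrite /ball /=; apply: (@le_lt_trans _ _ n.+1%:R^-1).
    by apply: floor_grid_near; rewrite !ltW.
  by rewrite ltr_pMl// ltr1n.
- move=> n; rewrite grid_measure lebesgue_measure_ball ?mulr_ge0 ?(ltW (e0 _))//.
  by rewrite -EFinM lee_fin mulr2n -mulrDl -natrD.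
Qed.

(** At a Lebesgue point F x is the limit of the averages over its grid cells, and these lie within
    [b0, d0] once the step is below the distance from x to both ends. *)
Lemma ae_le_of_grid_integral (F : R -> R) (M b0 d0 : R) :
  mu.-integrable setT (EFin \o F) ->
  (forall n k, b0 <= k%:~R / n.+1%:R -> (k + 1)%:~R / n.+1%:R <= d0 ->
     \int[mu]_(y in grid n k) F y <= M / n.+1%:R) ->
  {ae mu, forall x, b0 < x < d0 -> F x <= M}.
Proof.
move=> Fi H.
have Fl : locally_integrable setT F.
  by apply: open_integrable_locally => //; exact: openT.
apply: (@filterS _ _ (ae_filter_ringOfSetsType mu) _ _ _ (lebesgue_differentiation Fl)) => x Lx /andP[bx xd].
have cv := @nice_lebesgue_differentiation R _ grid_nicely_shrinking F Fl x Lx.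
rewrite -lee_fin; apply: (cvge_to_le cv).
have small y : 0 < y -> \forall n \near \oo, (n.+1%:R^-1 : R) <= y.
  move=> y0; have /cvgrPdist_le /(_ y y0) := @cvg_harmonic R.
  by apply: filterS => n; rewrite sub0r normrN gtr0_norm ?invr_gt0.
have xb : 0 < x - b0 by rewrite subr_gt0.
have dx : 0 < d0 - x by rewrite subr_gt0.
apply: filterS2 (small _ xb) (small _ dx) => n nb nd.
set k := Num.floor _.
have /andP[kx xk] := floor_grid x n; rewrite -/k in kx xk.
have E : (k + 1)%:~R / n.+1%:R = k%:~R / n.+1%:R + n.+1%:R^-1 :> R.
  by rewrite intrD mulrDl mul1r.
rewrite E in xk.
have h1 : b0 <= k%:~R / n.+1%:R.
  have gen (a e : R) : x < a + e -> e <= x - b0 -> b0 <= a by move=> *; lra.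
  exact: gen xk nb.
have h2 : (k + 1)%:~R / n.+1%:R <= d0.
  have gen (a e : R) : a <= x -> e <= d0 - x -> a + e <= d0 by move=> *; lra.
  by rewrite E; exact: gen kx nd.
have gF : mu.-integrable (grid n k) (EFin \o F).
  by apply: integrableS Fi => //; exact: measurable_itv.
have := H n k h1 h2.
rewrite -lee_fin /Rintegral fineK; last first.
  by apply: integrable_fin_num => //; exact: measurable_itv.
rewrite grid_measure inver gt_eqF ?invr_gt0// invrK => HI.
by rewrite muleC -lee_pdivlMr// -EFinM.
Qed.

(** The inner integral is real-valued and takes the default value 0 where the extended integral is
    infinite; those w form a null set, the Fubini function being integrable. *)
Lemma Rintegral_rect_fubini (f : R * R -> R) (a c b d : R) :
  leb2.-integrable setT (EFin \o f) ->
  let F w := \int[mu]_(y in `]b, d[) f (w, y) in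
  mu.-integrable setT (EFin \o F) /\
  \int[mu]_(w in `]a, c[) F w = \int[leb2]_(x in rect a c b d) f x.
Proof.
move=> fi F.
have mindic (p q : R) : measurable_fun setT (\1_`]p, q[ : R -> R) by exact: measurable_indic.
have fki (k : R * R -> R) : measurable_fun setT k -> (forall x, `|k x| <= 1) ->
    leb2.-integrable setT (EFin \o (fun x => f x * k x)).
  by move=> mk k1; exact: (integrable_mul_bounded measurableT (B := 1)).
have i1 (p q w : R) : `|\1_`]p, q[ w : R| <= 1.
  by rewrite indicE; case: (_ \in _); rewrite ?normr1 ?normr0.
pose f1 x := f x * \1_`]b, d[ x.2.
have f1i : leb2.-integrable setT (EFin \o f1).
  apply: fki => [|x]; last exact: i1.
  exact: (measurableT_comp (mindic b d) measurable_snd).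
pose F1 := fubini_F mu (EFin \o f1).
have FE w : F w = fine (F1 w).
  rewrite /F /Rintegral integral_mkcond; congr fine; apply: eq_integral => y _.
  by rewrite restrict_EFin /f1 /= patchE indicE; case: (_ \in _); rewrite ?mulr1 ?mulr0.
have F1i : mu.-integrable setT F1 by exact: integrable_fubini_F.
have mF1 := measurable_int _ F1i.
have mF : measurable_fun setT (EFin \o F).
  rewrite (_ : F = fine \o F1); last by apply/funext => w; rewrite FE.
  by apply/measurable_EFinP; apply: measurableT_comp.
have Fi : mu.-integrable setT (EFin \o F).
  apply: (@le_integrable _ _ _ mu setT measurableT (EFin \o F) F1 mF _ F1i) => w _ /=.
  by rewrite FE; case: (F1 w) => [r| |] //=; rewrite ?normr0 ?leey ?lee_fin.
split => //.
pose f2 x := f1 x * \1_`]a, c[ x.1.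
have f2i : leb2.-integrable setT (EFin \o f2).
  apply: (integrable_mul_bounded measurableT (B := 1) f1i) => [|x _]; last exact: i1.
  exact: (measurableT_comp (mindic a c) measurable_fst).
have E2 : \int[leb2]_(x in rect a c b d) f x = \int[leb2]_x f2 x.
  rewrite -(@Rintegral_indic R setT)//; apply: eq_Rintegral => x _.
  by rewrite -indic_rect /f2 /f1; ring.
rewrite E2 /Rintegral -(integral12_prod_meas1 f2i) integral_mkcond; congr fine.
apply: ae_eq_integral => //.
- apply/(measurable_restrictT _ _).1 => //.
  exact: measurable_funS mF.
- exact: (measurable_int _ (integrable_fubini_F f2i)).
- apply: (@filterS _ _ (ae_filter_ringOfSetsType mu) _ _ _ (integrable_ae measurableT F1i)).
  move=> w /(_ I) F1w _.
  rewrite patchE /fubini_F /f2 /=.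
  case: (boolP (w \in _)) => wac.
    rewrite FE fineK//; apply: eq_integral => y _.
    by rewrite indicE wac mulr1.
  under eq_integral do rewrite indicE (negbTE wac) mulr0.
  by rewrite integral0.
Qed.

(** Differentiation in omega comes first, for the integral over each grid cell in R; outside one
    null set of w all these integrals are bounded. For such w the slice is differentiated in R, so
    the section at w of the set where f > M is null, and Fubini concludes. Extension by 0 makes
    slices integrable on the whole line. *)
Lemma ae_le_of_rect_integral (f : R * R -> R) (a c b d M : R) :
  leb2.-integrable (rect a c b d) (EFin \o f) ->
  (forall a' c' b' d', a <= a' -> a' < c' -> c' <= c -> b <= b' -> b' < d' ->
     d' <= d ->
     \int[leb2]_(x in rect a' c' b' d') f x <= M * (c' - a') * (d' - b')) ->
  {ae leb2, forall x, rect a c b d x -> f x <= M}.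
Proof.
move=> fi H; pose D := rect a c b d.
have mD := measurable_rect a c b d.
pose f0 := f \_ D.
have f0i : leb2.-integrable setT (EFin \o f0).
  by have := (integrable_mkcond _ mD).1 fi; rewrite restrict_EFin.
have gridlt n k : k%:~R / n.+1%:R < (k + 1)%:~R / n.+1%:R :> R.
  by rewrite ltr_pM2r ?invr_gt0// ltr_int ltrDl.
have gridE n k : (k + 1)%:~R / n.+1%:R - k%:~R / n.+1%:R = n.+1%:R^-1 :> R.
  by rewrite -mulrBl intrD addrAC subrr add0r mul1r.
have step1 n k : b <= k%:~R / n.+1%:R -> (k + 1)%:~R / n.+1%:R <= d ->
    {ae mu, forall w, a < w < c -> \int[mu]_(y in grid n k) f0 (w, y) <= M / n.+1%:R}.
  move=> bk kd.
  apply: ae_le_of_grid_integral.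
    by have [] := Rintegral_rect_fubini 0 0 (k%:~R / n.+1%:R) ((k + 1)%:~R / n.+1%:R) f0i.
  move=> m j aj jc.
  have [_] := Rintegral_rect_fubini (j%:~R / m.+1%:R) ((j + 1)%:~R / m.+1%:R)
    (k%:~R / n.+1%:R) ((k + 1)%:~R / n.+1%:R) f0i.
  rewrite /grid => ->.
  have := H _ _ _ _ aj (gridlt m j) jc bk (gridlt n k) kd.
  rewrite !gridE mulrAC; apply: le_trans.
  rewrite le_eqVlt; apply/orP; left; apply/eqP; apply: eq_Rintegral => x.
  rewrite inE => -[]; rewrite /= !in_itv /= => /andP[h1 h2] /andP[h3 h4].
  rewrite /f0 patchE mem_set//; split; rewrite /= in_itv /=.
    by rewrite (le_lt_trans aj h1) (lt_le_trans h2 jc).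
  by rewrite (le_lt_trans bk h3) (lt_le_trans h4 kd).
pose N := D `&` f @^-1` `]M, +oo[.
have /measurable_EFinP mfD := measurable_int _ fi.
have mN := mfD mD _ (measurable_itv `]M, +oo[).
suff N0 : leb2 N = 0.
  exists N; split => // x /= /not_implyP[Dx /negP]; rewrite -ltNge => Mf.
  by split => //=; rewrite in_itv /= Mf.
have : {ae mu, forall w, mu (xsection N w) = 0}.
  have S1 : {ae mu, forall w, forall i : nat * int,
      b <= i.2%:~R / i.1.+1%:R -> (i.2 + 1)%:~R / i.1.+1%:R <= d ->
      a < w < c -> \int[mu]_(y in grid i.1 i.2) f0 (w, y) <= M / i.1.+1%:R}.
    apply: ae_forall_countType => -[n k] /=.
    have [bk|] := boolP (b <= k%:~R / n.+1%:R); last by move=> _; exact: aeW.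
    have [kd|] := boolP ((k + 1)%:~R / n.+1%:R <= d); last by move=> _; exact: aeW.
    apply: (@filterS _ _ (ae_filter_ringOfSetsType mu) _ _ _ (step1 n k bk kd)).
    by move=> w Hw _ _.
  apply: (@filterS2 _ _ (ae_filter_ringOfSetsType mu) _ _ _ _ S1 (ae_integrable1 f0i)).
  move=> w Hw f0w.
  have [/andP[aw wc]|nw] := boolP (a < w < c); last first.
    rewrite (_ : xsection N w = set0) ?measure0//.
    apply/seteqP; split => y //; rewrite /xsection /= inE => -[[]] /=.
    by rewrite in_itv /= (negbTE nw).
  have awc : a < w < c by rewrite aw.
  have := @ae_le_of_grid_integral (fun y => f0 (w, y)) M b d f0w.
  move=> /(_ (fun n k bk kd => Hw (n, k) bk kd awc)) [Z [mZ Z0 sZ]].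
  apply: (subset_measure0 _ mZ _ Z0); first exact: measurable_xsection.
  move=> y; rewrite /xsection /= inE => -[Dwy /=]; rewrite in_itv /= andbT => Mf; apply: sZ => /=.
  have byd : b < y < d by move: Dwy => [_] /=; rewrite in_itv.
  by move=> /(_ byd); rewrite /f0 patchE mem_set// leNgt Mf.
move=> ae0.
rewrite [LHS](_ : _ = \int[mu]_w (mu \o xsection N) w)%E//.
rewrite (ae_eq_integral (cst 0%E))//; first by rewrite integral0.
- exact: measurable_fun_xsection.
- by apply: (@filterS _ _ (ae_filter_ringOfSetsType mu) _ _ _ ae0) => w /= -> _.
Qed.

End lebesgue_points.

(** * From L^p bounds to the Morrey estimate on one box *)

Lemma le_add_powR (R : realType) (x K p : R) : 0 <= x -> 0 < K -> 1 <= p ->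
  x <= K + K `^ (1 - p) * x `^ p.
Proof.
move=> x0 K0 p1; have [xK|/ltW Kx] := leP x K.
  by rewrite (le_trans xK)// lerDl mulr_ge0 ?powR_ge0.
have x0' : 0 < x by exact: lt_le_trans Kx.
(* Above K one has x^(p-1) >= K^(p-1), so the second term alone dominates x. *)
apply: (@le_trans _ _ (K `^ (1 - p) * x `^ p)); last by rewrite lerDr ltW.
have -> : x `^ p = x `^ (p - 1) * x.
  rewrite -[X in _ = _ * X](powRr1 x0) -powRD ?subrK//.
  by rewrite (gt_eqF x0') implybT.
rewrite mulrA ler_peMl//.
rewrite -(opprB p 1) powRN mulrC ler_pdivlMr ?powR_gt0// mul1r.
by rewrite ge0_ler_powR ?nnegrE ?subr_ge0 ?(ltW K0).
Qed.

(** Hölder's inequality up to the factor 2, by integrating [le_add_powR]. The choice K = A V^(-1/p)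
    balances its two terms, each contributing at most A V V^(-1/p). *)
Lemma Rintegral_norm_le_Lp d (T : measurableType d) (R : realType)
    (mu : {measure set T -> \bar R}) (D : set T) (g : T -> R) (V p A : R) :
  measurable D -> mu.-integrable D (EFin \o g) -> mu D = V%:E -> 0 < V ->
  1 < p -> 0 < A ->
  (\int[mu]_(x in D) (`|g x| `^ p)%:E <= (A `^ p)%:E)%E ->
  \int[mu]_(x in D) `|g x| <= 2 * A * V * V `^ (- p^-1).
Proof.
move=> mD gi DV V0 p1 A0 gA.
have p0 : 0 < p by rewrite (lt_trans _ p1).
have mg : measurable_fun D g by apply/measurable_EFinP/(measurable_int _ gi).
have mng : measurable_fun D (fun x => `|g x|) by exact: measurableT_comp.
have mgp : measurable_fun D (fun x => (`|g x| `^ p)%:E).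
  by apply/measurable_EFinP; apply: (measurableT_comp (measurable_powR p)).
pose K := A * V `^ (- p^-1).
have K0 : 0 < K by rewrite mulr_gt0 ?powR_gt0.
have Kp : 0 <= K `^ (1 - p) by exact: powR_ge0.
rewrite -lee_fin /Rintegral fineK; last first.
  by apply: integrable_fin_num => //; exact: integrable_norm.
apply: (@le_trans _ _ (\int[mu]_(x in D) (K%:E + (K `^ (1 - p))%:E * (`|g x| `^ p)%:E))%E).
  apply: ge0_le_integral => //.
  - by apply/measurable_EFinP.
  - by apply: emeasurable_funD => //; apply: measurable_funeM.
  - by move=> x _; rewrite -EFinM -EFinD lee_fin le_add_powR// ltW.
rewrite ge0_integralD//; last 3 first.
- by move=> x _; rewrite lee_fin ltW.
- by move=> x _; rewrite -EFinM lee_fin mulr_ge0 ?powR_ge0.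
- exact: measurable_funeM.
rewrite integral_cst// DV ge0_integralZl_EFin//.
apply: (@le_trans _ _ (K%:E * V%:E + (K `^ (1 - p))%:E * (A `^ p)%:E)%E).
  by rewrite leeD2l// lee_wpmul2l// lee_fin.
rewrite -!EFinM -EFinD lee_fin.
have -> : K `^ (1 - p) * A `^ p = A * V * V `^ (- p^-1).
  rewrite /K powRM ?powR_ge0 ?(ltW A0)// -powRrM mulrAC -powRD; last first.
    by rewrite (gt_eqF A0) implybT.
  rewrite subrK (powRr1 (ltW A0)) -mulrA; congr (_ * _).
  rewrite -[X in _ = X * _](powRr1 (ltW V0)) -powRD; last first.
    by rewrite (gt_eqF V0) implybT.
  by congr (_ `^ _); field; rewrite gt_eqF.
by rewrite le_eqVlt; apply/orP; left; apply/eqP; rewrite /K; ring.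
Qed.

Section morrey.
Variable R : realType.
Local Notation leb2 := (@lebesgue_measure R \x @lebesgue_measure R)%E.

Lemma rect_measure (a c b d : R) : a <= c -> b <= d ->
  leb2 (rect a c b d) = ((c - a) * (d - b))%:E.
Proof.
have len (p q : R) : p <= q -> lebesgue_measure `]p, q[%classic = (q - p)%:E.
  move=> pq; rewrite lebesgue_measure_itv /= lte_fin.
  by case: ltgtP pq => // -> _; rewrite subrr.
move=> ac bd; rewrite /rect product_measure1E//; try exact: measurable_itv.
by rewrite EFinM; congr (_ * _)%E; exact: len.
Qed.

(** The constant of [mean_bound] at s = 1/p; the inverse is the sum of the geometric series. *)
Definition morrey_cst (p : R) : R := 4 * (1 + (1 - 2^-1 `^ (1 - 2 * p^-1))^-1).

Lemma morrey_cst_ge0 p : 2 < p -> 0 <= morrey_cst p.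
Proof.
move=> p2; have p0 : 0 < p by rewrite (lt_trans _ p2).
have hs : 0 < p^-1 < 2^-1 by rewrite invr_gt0 p0 /= ltf_pV2 ?posrE.
have /andP[_ /ltW r1] := rho_lt1 hs.
by rewrite mulr_ge0// addr_ge0// invr_ge0 subr_ge0.
Qed.

Lemma rect_integral_morrey (th0 R0 b0 T p A B : R) (f g h : R * R -> R) :
  0 < th0 -> R0 <= b0 -> 0 < T -> 2 < p -> 0 < A -> 0 < B ->
  weak_dw th0 R0 f g -> weak_dR th0 R0 f h -> zero_at_w0 th0 R0 f ->
  (\int[leb2]_(x in rect 0 th0 b0 (b0 + T)) (`|g x| `^ p)%:E <= (A `^ p)%:E)%E ->
  (\int[leb2]_(x in rect 0 th0 b0 (b0 + T)) (`|h x| `^ p)%:E <= (B `^ p)%:E)%E ->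
  forall a c b d, 0 <= a -> a < c -> c <= th0 -> b0 <= b -> b < d -> d <= b0 + T ->
  `|\int[leb2]_(x in rect a c b d) f x| <=
    morrey_cst p * (A * th0 + B * T) * (th0 * T) `^ (- p^-1) * (c - a) * (d - b).
Proof.
move=> th0_gt0 R0b T0 p2 A0 B0 Wg Wh Z gA hB a c b d a0 ac cth bb bd dT.
have p1 : 1 < p by rewrite (lt_trans _ p2)// ltr1n.
have p0 : 0 < p by rewrite (lt_trans _ p1).
have hs : 0 < p^-1 < 2^-1 by rewrite invr_gt0 p0 /= ltf_pV2 ?posrE.
have [fi gi _] := Wg; have [_ hi _] := Wh.
have mom := @measurable_OmegaM R th0 R0.
have ri k a1 c1 b1 d1 : loc_integrable th0 R0 k -> 0 <= a1 -> c1 <= th0 -> b0 <= b1 ->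
    leb2.-integrable (rect a1 c1 b1 d1) (EFin \o k).
  move=> ki a10 c1th b1b.
  apply: (integrableS (mom d1) (measurable_rect _ _ _ _) _ (ki d1)).
  by apply: rect_sub_OmegaM => //; exact: le_trans b1b.
have Lp k E a1 c1 b1 d1 : 0 < E -> loc_integrable th0 R0 k ->
    (\int[leb2]_(x in rect 0%R th0 b0 (b0 + T)) (`|k x| `^ p)%:E <= (E `^ p)%:E)%E ->
    0 <= a1 -> a1 < c1 -> c1 <= th0 -> b0 <= b1 -> b1 < d1 -> d1 <= b0 + T ->
    \int[leb2]_(x in rect a1 c1 b1 d1) `|k x| <=
    2 * E * ((c1 - a1) * (d1 - b1)) * ((c1 - a1) * (d1 - b1)) `^ (- p^-1).
  move=> E0 ki kE a10 ac1 c1th b1b bd1 d1T.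
  have ki1 : leb2.-integrable (rect 0 th0 b0 (b0 + T)) (EFin \o k) by exact: ri.
  have/measurable_EFinP mk := measurable_int _ ki1.
  apply: Rintegral_norm_le_Lp => //.
  - exact: measurable_rect.
  - exact: ri.
  - exact: (rect_measure (ltW ac1) (ltW bd1)).
  - by rewrite mulr_gt0 ?subr_gt0.
  - apply: le_trans kE; apply: ge0_subset_integral => //.
    + exact: measurable_rect.
    + exact: measurable_rect.
    + apply/measurable_EFinP; apply: (measurableT_comp (measurable_powR p)).
      exact: measurableT_comp.
    + move=> x [] /=; rewrite !in_itv /= => /andP[x1 x2] /andP[x3 x4].
      split; rewrite /= in_itv /=.
        by rewrite (le_lt_trans a10 x1) (lt_le_trans x2 c1th).
      by rewrite (le_lt_trans b1b x3) (lt_le_trans x4 d1T).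
pose S k a c b d : R := \int[leb2]_(x in rect a c b d) k x.
(* The two normalizations are kept apart, because each averaging lemma normalizes in one variable
   only. *)
pose m a c b d : R := (c - a)^-1 * ((d - b)^-1 * S f a c b d).
have := @mean_bound R th0 T b0 p^-1 A B th0_gt0 T0 hs (ltW A0) (ltW B0) m
  (S (fun x => `|g x|)) (S (fun x => `|h x|)).
move=> /(_ _ _ _ _ _ a c b d a0 ac cth bb bd dT) mb.
suff : `|m a c b d| <= morrey_cst p * (A * th0 + B * T) * (th0 * T) `^ (- p^-1).
  have L0 : 0 < c - a by rewrite subr_gt0.
  have W0 : 0 < d - b by rewrite subr_gt0.
  rewrite /m /S 2!normrM 2!normfV (gtr0_norm L0) (gtr0_norm W0) mulrA -invfM.
  by rewrite mulrC ler_pdivrMr ?mulr_gt0// mulrA.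
apply: mb.
- by move=> *; exact: Lp.
- by move=> *; exact: Lp.
- move=> a1 a' c1 c' b1 d1 a10 aa' ac' c'c c1th b1b bd1 d1T.
  rewrite [X in `|X|](_ : _ = (d1 - b1)^-1 * ((c' - a')^-1 * S f a' c' b1 d1
    - (c1 - a1)^-1 * S f a1 c1 b1 d1)); last by rewrite /m; ring.
  rewrite normrM ger0_norm; last first.
    by rewrite invr_ge0 subr_ge0 ltW.
  rewrite ler_wpM2l ?invr_ge0 ?subr_ge0 ?(ltW bd1)//.
  by apply: (average_diff_w (th0 := th0) (R0 := R0)) => //; exact: le_trans b1b.
- move=> a1 c1 b1 b' d1 d' a10 ac1 c1th b1b bb' bd' d'd d1T.
  rewrite /m -mulrBr normrM ger0_norm; last first.
    by rewrite invr_ge0 subr_ge0 ltW.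
  rewrite ler_wpM2l ?invr_ge0 ?subr_ge0 ?(ltW ac1)//.
  by apply: (average_diff_R (th0 := th0) (R0 := R0)) => //; exact: le_trans b1b.
- move=> b1 d1 b1b bd1 d1T.
  rewrite /m subr0 mulrCA normrM ger0_norm; last first.
    by rewrite invr_ge0 subr_ge0 ltW.
  rewrite ler_wpM2l ?invr_ge0 ?subr_ge0 ?(ltW bd1)//.
  by apply: (average_trace_w (R0 := R0)) => //; exact: le_trans b1b.
Qed.

Lemma ae_morrey (th0 R0 b0 T p A B : R) (f g h : R * R -> R) :
  0 < th0 -> R0 <= b0 -> 0 < T -> 2 < p -> 0 < A -> 0 < B ->
  weak_dw th0 R0 f g -> weak_dR th0 R0 f h -> zero_at_w0 th0 R0 f ->
  (\int[leb2]_(x in rect 0 th0 b0 (b0 + T)) (`|g x| `^ p)%:E <= (A `^ p)%:E)%E ->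
  (\int[leb2]_(x in rect 0 th0 b0 (b0 + T)) (`|h x| `^ p)%:E <= (B `^ p)%:E)%E ->
  {ae leb2, forall x, rect 0 th0 b0 (b0 + T) x ->
    `|f x| <= morrey_cst p * (A * th0 + B * T) * (th0 * T) `^ (- p^-1)}.
Proof.
move=> th0_gt0 R0b T0 p2 A0 B0 Wg Wh Z gA hB.
have H := rect_integral_morrey th0_gt0 R0b T0 p2 A0 B0 Wg Wh Z gA hB.
have [fi _ _] := Wg.
have fD : leb2.-integrable (rect 0 th0 b0 (b0 + T)) (EFin \o f).
  apply: (integrableS (measurable_OmegaM _ _ _) (measurable_rect _ _ _ _) _ (fi (b0 + T))).
  exact: rect_sub_OmegaM.
set M := _ * _ `^ _ in H *.
have H1 : {ae leb2, forall x, rect 0 th0 b0 (b0 + T) x -> f x <= M}.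
  apply: ae_le_of_rect_integral => // *.
  by apply: le_trans (ler_norm _) _; exact: H.
have H2 : {ae leb2, forall x, rect 0 th0 b0 (b0 + T) x -> - f x <= M}.
  apply: ae_le_of_rect_integral => [|a c b d a0 ac cth bb bd dT].
    exact: (integrableN fD).
  have ri : leb2.-integrable (rect a c b d) (EFin \o f).
    apply: (integrableS (measurable_OmegaM _ _ _) (measurable_rect _ _ _ _) _ (fi d)).
    by apply: rect_sub_OmegaM => //; exact: le_trans bb.
  under eq_Rintegral do rewrite -mulN1r.
  rewrite RintegralZl//; last exact: measurable_rect.
  by rewrite mulN1r; apply: le_trans (ler_norm _) _; rewrite normrN; exact: H.
apply: (@filterS2 _ _ (ae_filter_ringOfSetsType leb2) _ _ _ _ H1 H2) => x h1 h2 Dx.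
by rewrite ler_norml lerNl h1// h2.
Qed.

End morrey.

(** * The weighted estimate *)

Section estimates.
Variable R : realType.
Local Notation leb2 := (@lebesgue_measure R \x @lebesgue_measure R)%E.

Lemma loc_integrable_measurable (th0 R0 : R) (g : R * R -> R) :
  loc_integrable th0 R0 g ->
  measurable_fun (Omega th0 R0 : set (measurableTypeR R * measurableTypeR R)) g.
Proof.
move=> gi.
have -> : Omega th0 R0 = \bigcup_n (Omega th0 R0 `&` [set x | x.2 <= n%:R]).
  apply/seteqP; split => [x Ox|x [n _ []]//].
  have [n xn] : exists n : nat, x.2 <= n%:R.
    by exists (Num.truncn `|x.2|).+1; rewrite (le_trans (ler_norm _))// ltW// truncnS_gt.
  by exists n.
apply/measurable_fun_bigcup => n; first exact: measurable_OmegaM.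
by have /measurable_EFinP := measurable_int _ (gi n%:R).
Qed.

(** With the weight at least w on E, the weighted term gives the integral of |g|^2q at most w^-1
    (z^2 / e)^q. This is written as a 2q-th power to serve as the A or B of [ae_morrey]. *)
Lemma cell_Lp_bound (th0 R0 q e w z : R) (E : set (measurableTypeR R * measurableTypeR R))
    (g wt : R * R -> R) :
  1 < q -> 0 < e -> 0 < w -> 0 < z -> measurable E -> E `<=` Omega th0 R0 ->
  loc_integrable th0 R0 g ->
  measurable_fun (Omega th0 R0 : set (measurableTypeR R * measurableTypeR R)) wt ->
  (forall x, Omega th0 R0 x -> 0 <= wt x) -> (forall x, E x -> w <= wt x) ->
  (e%:E * iint th0 R0 (fun x => `|g x| `^ (2 * q) * wt x)%R `^ q^-1 <= (z ^+ 2)%:E)%E ->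
  (\int[leb2]_(x in E) (`|g x| `^ (2 * q))%:E <=
    ((z * e `^ (- 2^-1) * w `^ (- (2 * q)^-1)) `^ (2 * q))%:E)%E.
Proof.
move=> q1 e0 w0 z0 mE EO gi mwt wt0 wtw H.
have q0 : 0 < q by rewrite (lt_trans _ q1).
have mg := loc_integrable_measurable gi.
have mgp : measurable_fun (Omega th0 R0 : set (measurableTypeR R * measurableTypeR R))
    (fun x => `|g x| `^ (2 * q)).
  by apply: (measurableT_comp (measurable_powR _)); exact: measurableT_comp.
set I := iint _ _ _ in H.
have I0 : (0 <= I)%E.
  by apply: integral_ge0 => x Ox; rewrite lee_fin mulr_ge0 ?powR_ge0 ?wt0.
have IE : (w%:E * \int[leb2]_(x in E) (`|g x| `^ (2 * q))%:E <= I)%E.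
  rewrite -ge0_integralZl_EFin//; last 2 first.
  - by apply/measurable_EFinP; exact: (measurable_funS (measurable_Omega th0 R0) EO mgp).
  - exact: ltW.
  apply: (@le_trans _ _ (\int[leb2]_(x in E) (`|g x| `^ (2 * q) * wt x)%:E)%E).
    apply: ge0_le_integral => //.
    - by move=> x Ex; rewrite -EFinM lee_fin mulr_ge0 ?powR_ge0 ?ltW.
    - apply: measurable_funeM; apply/measurable_EFinP.
      exact: (measurable_funS (measurable_Omega th0 R0) EO mgp).
    - apply/measurable_EFinP; apply: measurable_funM.
        exact: (measurable_funS (measurable_Omega th0 R0) EO mgp).
      exact: (measurable_funS (measurable_Omega th0 R0) EO mwt).
    - move=> x Ex; rewrite -EFinM lee_fin mulrC ler_wpM2l ?powR_ge0//.
      exact: wtw.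
  apply: ge0_subset_integral => //.
  - exact: measurable_Omega.
  - by apply/measurable_EFinP; exact: measurable_funM.
  - by move=> x Ox; rewrite lee_fin mulr_ge0 ?powR_ge0 ?wt0.
have Iq : (I <= ((e^-1 * z ^+ 2) `^ q)%:E)%E.
  have h : (I `^ q^-1 <= (e^-1 * z ^+ 2)%:E)%E by rewrite EFinM lee_pdivlMl.
  have := gt0_ler_poweR (ltW q0) _ _ h.
  rewrite -poweRrM mulVf ?gt_eqF// poweRe1// poweR_EFin; apply.
  - by rewrite in_itv /= leey poweR_ge0.
  - by rewrite in_itv /= leey lee_fin mulr_ge0 ?sqr_ge0 ?invr_ge0 ?ltW.
have -> : (z * e `^ (- 2^-1) * w `^ (- (2 * q)^-1)) `^ (2 * q) =
    w^-1 * (e^-1 * z ^+ 2) `^ q.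
  rewrite -(@powR_mulrn _ z 2) ?(ltW z0)//.
  rewrite !powRM ?mulr_ge0 ?powR_ge0 ?invr_ge0 ?(ltW z0) ?(ltW e0)//.
  rewrite -!powRrM [X in w `^ X](_ : _ = - 1); last by field; rewrite gt_eqF.
  rewrite powR_inv1 ?(ltW w0)//.
  rewrite -[X in X `^ q]powR_inv1 ?(ltW e0)// -powRrM.
  rewrite [X in e `^ X](_ : _ = -1 * q); last by field.
  by ring.
by rewrite EFinM lee_pdivlMl// (le_trans IE).
Qed.

Lemma rvar_ge (R0 eps : R) x : R0 <= x.2 -> R0 <= rvar R0 eps x.
Proof. by move=> Rx; rewrite lerDl mulr_ge0 ?sqrtr_ge0 ?subr_ge0. Qed.

Lemma ge_powR_neg (a x y : R) : a <= 0 -> 0 < x -> x <= y -> y `^ a <= x `^ a.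
Proof.
move=> a0 x0 xy; rewrite -(opprK a) !(powRN _ (- a)).
rewrite lef_pV2 ?posrE ?powR_gt0// ?(lt_le_trans x0 xy)//.
by rewrite ge0_ler_powR ?nnegrE ?oppr_ge0// ltW// (lt_le_trans x0 xy).
Qed.

Lemma measurable_rvar (R0 eps : R) :
  measurable_fun (setT : set (measurableTypeR R * measurableTypeR R)) (rvar R0 eps).
Proof.
apply: measurable_funD => //; apply: measurable_funM => //.
by apply: measurable_funB => //; exact: measurable_snd.
Qed.

(** The exponent [kappa] is the growth in r1 granted to the omega-derivative: 0 for u, (q - 1)/4q
    for v. Both powers of r1 in the resulting cell bound are nonpositive, so r1 may be replaced by
    R0. *)
Lemma ae_bound_Omega (th0 R0 q alpha kappa eps A B : R) (f g h : R * R -> R)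
    (r1 := fun R1 : R => rvar R0 eps (0, R1))
    (cell := fun R1 : R => rect 0 th0 R1 (R1 + r1 R1)) :
  0 < th0 -> 0 < R0 -> 1 < q -> q - 1 <= alpha -> kappa <= (2 * q)^-1 ->
  0 < A -> 0 < B ->
  weak_dw th0 R0 f g -> weak_dR th0 R0 f h -> zero_at_w0 th0 R0 f ->
  (forall R1, R0 <= R1 -> (\int[leb2]_(x in cell R1) (`|g x| `^ (2 * q))%:E <=
     ((A * (2 * r1 R1) `^ kappa) `^ (2 * q))%:E)%E) ->
  (forall R1, R0 <= R1 -> (\int[leb2]_(x in cell R1) (`|h x| `^ (2 * q))%:E <=
     ((B * r1 R1 `^ (- ((q + alpha) / (2 * q)))) `^ (2 * q))%:E)%E) ->
  {ae leb2, forall x, Omega th0 R0 x -> `|f x| <= morrey_cst (2 * q) *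
     (A * (th0 * th0 `^ (- (2 * q)^-1) * 2 `^ kappa * R0 `^ (kappa - (2 * q)^-1)) +
      B * (th0 `^ (- (2 * q)^-1) * R0 `^ ((q - 1 - alpha) / (2 * q))))}.
Proof.
move=> th0_gt0 R0_gt0 q1 qa kq A0 B0 Wg Wh Z Hg Hh.
have q0 : 0 < q by rewrite (lt_trans _ q1).
have r1R R1 : R0 <= R1 -> R0 <= r1 R1 by move=> R01; exact: rvar_ge.
have cst0 : 0 <= morrey_cst (2 * q) by apply: morrey_cst_ge0; rewrite ltr_pMr.
have cellB R1 : R0 <= R1 -> {ae leb2, forall x, cell R1 x -> `|f x| <= morrey_cst (2 * q) *
     (A * (th0 * th0 `^ (- (2 * q)^-1) * 2 `^ kappa * R0 `^ (kappa - (2 * q)^-1)) +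
      B * (th0 `^ (- (2 * q)^-1) * R0 `^ ((q - 1 - alpha) / (2 * q))))}.
  move=> R01; have Rr := r1R _ R01.
  have r0 : 0 < r1 R1 by exact: lt_le_trans Rr.
  have p2 : 2 < 2 * q by rewrite ltr_pMr.
  have A1 : 0 < A * (2 * r1 R1) `^ kappa by rewrite mulr_gt0 ?powR_gt0 ?mulr_gt0.
  have B1 : 0 < B * r1 R1 `^ (- ((q + alpha) / (2 * q))) by rewrite mulr_gt0 ?powR_gt0.
  have H := ae_morrey th0_gt0 R01 r0 p2 A1 B1 Wg Wh Z (Hg _ R01) (Hh _ R01).
  apply: (@filterS _ _ (ae_filter_ringOfSetsType leb2) _ _ _ H).
  move=> x Hx /Hx /le_trans; apply.
  rewrite -mulrA ler_wpM2l// mulrDl lerD//.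
  - rewrite !powRM ?(ltW th0_gt0) ?(ltW r0)//.
    rewrite [leLHS](_ : _ = A * (th0 * th0 `^ (- (2 * q)^-1) * 2 `^ kappa *
      (r1 R1 `^ kappa * r1 R1 `^ (- (2 * q)^-1)))); last by ring.
    rewrite -powRD ?(gt_eqF r0) ?implybT//.
    rewrite ler_wpM2l ?(ltW A0)// ler_wpM2l ?mulr_ge0 ?powR_ge0 ?(ltW th0_gt0)//.
    by apply: ge_powR_neg => //; rewrite subr_le0.
  - rewrite powRM ?(ltW th0_gt0) ?(ltW r0)//.
    rewrite [leLHS](_ : _ = B * (th0 `^ (- (2 * q)^-1) *
      (r1 R1 `^ (- ((q + alpha) / (2 * q))) * r1 R1 `^ 1 * r1 R1 `^ (- (2 * q)^-1)))); last first.
      by rewrite powRr1 ?(ltW r0)//; ring.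
    rewrite -!powRD ?(gt_eqF r0) ?implybT//.
    rewrite ler_wpM2l ?(ltW B0)// ler_wpM2l ?powR_ge0//.
    rewrite [X in _ `^ X <= _](_ : _ = (q - 1 - alpha) / (2 * q)); last first.
      by field; rewrite gt_eqF.
    apply: ge_powR_neg => //; rewrite pmulr_lle0 ?invr_gt0 ?mulr_gt0//.
    by rewrite subr_le0.
(* Every cell is at least R0 long, so starting points spaced by R0 / 2 give a countable cover of
   Omega. *)
pose hh := R0 / 2; have hh0 : 0 < hh by rewrite divr_gt0.
pose R1 (j : int) := R0 + j%:~R * hh.
have R1R j : 0 <= j -> R0 <= R1 j by move=> j0; rewrite lerDl mulr_ge0 ?ler0z ?(ltW hh0).
set M := _ * (_ + _) in cellB *.
have : {ae leb2, forall x, forall j : int, 0 <= j -> cell (R1 j) x -> `|f x| <= M}.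
  apply: ae_forall_countType => j.
  have [j0|j0] := leP 0 j; last exact: aeW.
  apply: (@filterS _ _ (ae_filter_ringOfSetsType leb2) _ _ _ (cellB _ (R1R j j0))).
  by move=> x Hx _.
apply: (@filterS _ _ (ae_filter_ringOfSetsType leb2)) => x Hx [] /=.
rewrite !in_itv /= andbT => x1 xR.
have w0 : 0 < (x.2 - R0) / hh by rewrite divr_gt0// subr_gt0.
(* Ceiling minus one rather than floor: cells are open on the left, so [x.2] must lie strictly above
   [R1 j]. *)
pose j := Num.ceil ((x.2 - R0) / hh) - 1.
have /andP[c1 c2] := ceil_itv ((x.2 - R0) / hh).
have j0 : 0 <= j by rewrite subr_ge0 -gtz0_ge1 ceil_gt0.
apply: (Hx j j0); split; rewrite /= in_itv//=.
rewrite ltr_pdivlMr// in c1; rewrite ler_pdivrMr// in c2.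
apply/andP; split; first by rewrite /R1 -ltrBrDl.
have Rr := r1R _ (R1R j j0).
apply: (@le_lt_trans _ _ (R1 j + hh)); last by rewrite ltrD2l /hh; lra.
rewrite /R1 -addrA -lerBlDl (le_trans c2)// /j intrB.
by rewrite le_eqVlt; apply/orP; left; apply/eqP; ring.
Qed.

End estimates.

(** * Essential bounds and the terms of the Z-norm *)

Lemma Linfty_le (R : realType) (th0 R0 M : R) (f : R * R -> R) : 0 <= M ->
  {ae (@lebesgue_measure R \x @lebesgue_measure R)%E,
    forall x, Omega th0 R0 x -> `|f x| <= M} ->
  (Linfty th0 R0 f <= M%:E)%E.
Proof.
move=> M0 H; rewrite /Linfty unlock; case: ifPn => // _.
apply/ess_supP.
apply: (@filterS _ _ (ae_filter_ringOfSetsType _) _ _ _ H) => x Hx /=.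
rewrite patchE; case: (boolP (_ \in _)) => /=; last by rewrite normr0 lee_fin.
by rewrite inE => Ox; rewrite lee_fin Hx.
Qed.

Lemma le_summands (R : realType) (t1 t2 t3 t4 t5 t6 y : \bar R) :
  (0 <= t1)%E -> (0 <= t2)%E -> (0 <= t3)%E -> (0 <= t4)%E -> (0 <= t5)%E ->
  (0 <= t6)%E -> (t1 + t2 + t3 + t4 + t5 + t6 <= y)%E ->
  [/\ (t3 <= y)%E, (t4 <= y)%E, (t5 <= y)%E & (t6 <= y)%E].
Proof.
move=> t10 t20 t30 t40 t50 t60 le; split; apply: le_trans le.
- by do 3 apply: lee_paddr => //; apply: lee_paddl => //; exact: adde_ge0.
- by do 2 apply: lee_paddr => //; apply: lee_paddl => //; do 2 apply: adde_ge0 => //.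
- by apply: lee_paddr => //; apply: lee_paddl => //; do 3 apply: adde_ge0 => //.
- by apply: lee_paddl => //; do 4 apply: adde_ge0 => //.
Qed.

Lemma Znorm_sq_terms (R : realType) (th0 R0 eps gam q p alpha delta : R)
    (u uw uR vw vR rvR : R * R -> R) (r := rvar R0 eps) (y : \bar R) : 0 < eps ->
  (Znorm_sq th0 R0 eps gam q p alpha delta u uw uR vw vR rvR <= y)%E ->
  [/\ ((eps `^ gam)%:E *
        iint th0 R0 (fun x => `|uR x| `^ (2 * q) * r x `^ (q + alpha))%R `^ q^-1 <= y)%E,
      ((eps `^ gam)%:E *
        iint th0 R0 (fun x => `|vR x| `^ (2 * q) * r x `^ (q + alpha))%R `^ q^-1 <= y)%E,
      ((eps `^ gam)%:E * iint th0 R0 (fun x => `|uw x| `^ (2 * q))%R `^ q^-1 <= y)%E &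
      ((eps `^ (gam + 1))%:E *
        iint th0 R0 (fun x => `|vw x| `^ (2 * q) * r x `^ (- (q / (2 * p))))%R `^ q^-1 <= y)%E].
Proof.
move=> eps0; apply: le_summands.
- apply: integral_ge0 => x _; rewrite lee_fin.
  by do !apply: addr_ge0; apply: mulr_ge0; rewrite ?sqr_ge0 ?powR_ge0.
- apply: integral_ge0 => x _; rewrite lee_fin.
  apply: addr_ge0; apply: mulr_ge0; rewrite ?sqr_ge0 ?powR_ge0//.
  by apply: mulr_ge0; [exact: ltW|exact: sqr_ge0].
- by rewrite mule_ge0 ?lee_fin ?powR_ge0 ?poweR_ge0.
- by rewrite mule_ge0 ?lee_fin ?powR_ge0 ?poweR_ge0.
- by rewrite mule_ge0 ?lee_fin ?powR_ge0 ?poweR_ge0.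
- by rewrite mule_ge0 ?lee_fin ?powR_ge0 ?poweR_ge0.
Qed.

Lemma eps_powR_le1 (R : realType) (eps a b c : R) : 0 < eps <= 1 -> 0 <= a - b * c ->
  eps `^ a * (eps `^ b) `^ (- c) <= 1.
Proof.
move=> /andP[e0 e1] abc.
rewrite -powRrM -powRD ?(gt_eqF e0) ?implybT// mulrN.
have -> : 1 = eps `^ 0 by rewrite powRr0.
by apply: ger_powR => //; rewrite e0.
Qed.

(** After the prefactors of the norm are absorbed, the remaining exponents of eps are 1/4q twice and
    1/4q + 1/2; being nonnegative, they leave factors at most 1. *)
Lemma weighted_sum_le (R : realType) (eps gam q z k0 k1 k2 : R) (Lu Lv : \bar R) :
  0 < eps <= 1 -> 0 < q -> 0 < z -> 0 <= k0 -> 0 <= k1 -> 0 <= k2 ->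
  (Lu <= (z * (eps `^ gam) `^ (- 2^-1) * (k0 + k1))%:E)%E ->
  (Lv <= (z * (eps `^ (gam + 1)) `^ (- 2^-1) * k2 +
     z * (eps `^ gam) `^ (- 2^-1) * k1)%:E)%E ->
  ((eps `^ (gam / 2 + (4 * q)^-1))%:E * Lu
     + (eps `^ (gam / 2 + (4 * q)^-1 + 2^-1))%:E * Lv
   <= (((k0 + k1) + (k2 + k1) + 1) * z)%:E)%E.
Proof.
move=> eps01 q0 z0 k00 k10 k20 Hu Hv.
have q4 : 0 <= (4 * q)^-1 by rewrite invr_ge0 mulr_ge0// ltW.
have zk0 : 0 <= z * k0 by rewrite mulr_ge0// ltW.
have zk1 : 0 <= z * k1 by rewrite mulr_ge0// ltW.
have zk2 : 0 <= z * k2 by rewrite mulr_ge0// ltW.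
set a := gam / 2 + (4 * q)^-1.
have e1 : eps `^ a * eps `^ gam `^ (- 2^-1) <= 1.
  by apply: eps_powR_le1 => //; rewrite /a addrAC subrr add0r.
have e2 : eps `^ (a + 2^-1) * eps `^ (gam + 1) `^ (- 2^-1) <= 1.
  by apply: eps_powR_le1 => //; rewrite (_ : _ - _ = (4 * q)^-1)// /a; ring.
have e3 : eps `^ (a + 2^-1) * eps `^ gam `^ (- 2^-1) <= 1.
  apply: eps_powR_le1 => //; rewrite (_ : _ - _ = (4 * q)^-1 + 2^-1) ?addr_ge0//.
  by rewrite /a; ring.
have p1 : (0 <= (eps `^ a)%:E)%E by rewrite lee_fin powR_ge0.
have p2 : (0 <= (eps `^ (a + 2^-1))%:E)%E by rewrite lee_fin powR_ge0.
apply: (le_trans (leeD (lee_wpmul2l p1 Hu) (lee_wpmul2l p2 Hv))).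
rewrite -!EFinM -EFinD lee_fin.
have h1 := ler_wpM2l zk0 e1; have h2 := ler_wpM2l zk1 e1.
have h3 := ler_wpM2l zk2 e2; have h4 := ler_wpM2l zk1 e3.
have := lerD (lerD h1 h2) (lerD h3 h4).
move: (eps `^ a) (eps `^ (a + _)) (eps `^ gam `^ _) (eps `^ (gam + 1) `^ _).
move=> A B C D /le_trans H.
rewrite [leLHS](_ : _ = z * k0 * (A * C) + z * k1 * (A * C) +
  (z * k2 * (B * D) + z * k1 * (B * C))); last by ring.
apply: H; rewrite [leRHS](_ : _ = z * k0 * 1 + z * k1 * 1 + (z * k2 * 1 + z * k1 * 1) + z).
  by rewrite lerDl ltW.
by ring.
Qed.

(** The estimates on cells need strictly positive bounds, so they are proved for every z > 0 with Z
    <= z^2. Taking z = sqrt Z + e/C and letting e tend to 0 covers Z = 0 as well; Z = +oo is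
    immediate. *)
Lemma le_cst_mul_sqrt (R : realType) (L Z : \bar R) (C : R) : 0 < C -> (0 <= Z)%E ->
  (forall z : R, 0 < z -> (Z <= (z ^+ 2)%:E)%E -> (L <= (C * z)%:E)%E) ->
  (L <= C%:E * Z `^ 2^-1)%E.
Proof.
move=> C0; case: Z => [r| |] // Z0 H; last first.
  by rewrite poweRyr ?gt0_muley ?leey// lte_fin.
rewrite poweR_EFin -EFinM; apply/lee_addgt0Pr => e e0.
rewrite lee_fin in Z0; have s0 : 0 <= r `^ 2^-1 by exact: powR_ge0.
have eC : 0 < e / C by rewrite divr_gt0.
have := H (r `^ 2^-1 + e / C); rewrite ltr_wpDl// => /(_ isT).
rewrite mulrDr mulrCA divff ?gt_eqF// mulr1 EFinD; apply.
rewrite lee_fin [leLHS](_ : _ = (r `^ 2^-1) ^+ 2); last by rewrite powR12_sqrt// sqr_sqrtr.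
by rewrite lerXn2r ?nnegrE ?addr_ge0 ?lerDl ?(ltW eC).
Qed.

Section main_estimate.
Variables (R : realType) (R0 th0 gam q p alpha : R).
Hypotheses (hR0 : 0 < R0) (hth0 : 0 < th0) (hq : 1 < q) (hp : q / p = q - 1)
  (halpha : q - 1 <= alpha) (hq2 : q <= 2).

(** The exponent q/2p = (q - 1)/2 of the weight of v_omega, divided by 2q. *)
Let kappa := (q - 1) / (4 * q).
Let K0 (k : R) := morrey_cst (2 * q) *
  (th0 * th0 `^ (- (2 * q)^-1) * 2 `^ k * R0 `^ (k - (2 * q)^-1)).
Let K1 := morrey_cst (2 * q) *
  (th0 `^ (- (2 * q)^-1) * R0 `^ ((q - 1 - alpha) / (2 * q))).

(** The slope of r in R is sqrt eps <= 1, so over a length r1 it grows by at most r1. *)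
Lemma rvar_cell (eps R1 : R) (x : R * R) : 0 <= eps <= 1 -> R0 <= R1 ->
  rect 0 th0 R1 (R1 + rvar R0 eps (0, R1)) x ->
  rvar R0 eps (0, R1) <= rvar R0 eps x <= 2 * rvar R0 eps (0, R1).
Proof.
move=> /andP[eps0 eps1] R01 [_] /=; rewrite in_itv /= => /andP[h1 h2].
have s0 := sqrtr_ge0 eps.
have s1 : Num.sqrt eps <= 1 by rewrite -[leRHS]sqrtr1 ler_wsqrtr.
rewrite /rvar /= in h2 *.
by apply/andP; split; nra.
Qed.

Let cst0 : 0 <= morrey_cst (2 * q).
Proof. by apply: morrey_cst_ge0; rewrite ltr_pMr. Qed.

Let K0ge k : 0 <= K0 k.
Proof. by rewrite mulr_ge0// !mulr_ge0 ?powR_ge0// ltW. Qed.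

Let K1ge : 0 <= K1.
Proof. by rewrite mulr_ge0// mulr_ge0 ?powR_ge0. Qed.

Lemma Linfty_bounds (eps delta z : R) (u v uw uR vw vR rvR : R * R -> R) :
  0 < eps <= 1 -> 0 < z ->
  weak_dw th0 R0 u uw -> weak_dR th0 R0 u uR ->
  weak_dw th0 R0 v vw -> weak_dR th0 R0 v vR ->
  zero_at_w0 th0 R0 u -> zero_at_w0 th0 R0 v ->
  (Znorm_sq th0 R0 eps gam q p alpha delta u uw uR vw vR rvR <= (z ^+ 2)%:E)%E ->
  (Linfty th0 R0 u <= (z * (eps `^ gam) `^ (- 2^-1) * (K0 0 + K1))%:E)%E /\
  (Linfty th0 R0 v <= (z * (eps `^ (gam + 1)) `^ (- 2^-1) * K0 kappa +
     z * (eps `^ gam) `^ (- 2^-1) * K1)%:E)%E.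
Proof.
move=> /andP[eps0 eps1] z0 Wuw WuR Wvw WvR Zu Zv /(Znorm_sq_terms eps0)[HuR HvR Huw Hvw].
have q0 : 0 < q by rewrite (lt_trans _ hq).
have e01 : 0 <= eps <= 1 by rewrite ltW.
have eg : 0 < eps `^ gam by rewrite powR_gt0.
have eg1 : 0 < eps `^ (gam + 1) by rewrite powR_gt0.
have r1R R1 : R0 <= R1 -> 0 < rvar R0 eps (0, R1).
  by move=> R01; rewrite (lt_le_trans hR0)// rvar_ge.
have mwt a : measurable_fun (Omega th0 R0 : set (measurableTypeR R * measurableTypeR R))
    (fun x => rvar R0 eps x `^ a).
  apply: (measurable_funS measurableT) => //.
  by apply: (measurableT_comp (measurable_powR a)); exact: measurable_rvar.
have cellO R1 : R0 <= R1 -> rect 0 th0 R1 (R1 + rvar R0 eps (0, R1)) `<=` Omega th0 R0.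
  move=> R01 x [] /=; rewrite !in_itv /= => h /andP[h2 _]; split; rewrite /= in_itv //= andbT.
  exact: le_lt_trans h2.
have [_ uwi _] := Wuw; have [_ uRi _] := WuR; have [_ vwi _] := Wvw; have [_ vRi _] := WvR.
have A0 : 0 < z * (eps `^ gam) `^ (- 2^-1) by rewrite mulr_gt0 ?powR_gt0.
have A1 : 0 < z * (eps `^ (gam + 1)) `^ (- 2^-1) by rewrite mulr_gt0 ?powR_gt0.
have HR (g : R * R -> R) : loc_integrable th0 R0 g ->
    ((eps `^ gam)%:E * iint th0 R0
      (fun x => `|g x| `^ (2 * q) * rvar R0 eps x `^ (q + alpha))%R `^ q^-1 <= (z ^+ 2)%:E)%E ->
    forall R1, R0 <= R1 ->
    (\int[(@lebesgue_measure R \x @lebesgue_measure R)%E]_(x in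
      rect 0%R th0 R1 (R1 + rvar R0 eps (0%R, R1))) (`|g x| `^ (2 * q))%:E <=
     ((z * (eps `^ gam) `^ (- 2^-1) *
       rvar R0 eps (0, R1) `^ (- ((q + alpha) / (2 * q)))) `^ (2 * q))%:E)%E.
  move=> gi Hg R1 R01; have r1 := r1R _ R01.
  have -> : rvar R0 eps (0, R1) `^ (- ((q + alpha) / (2 * q))) =
      (rvar R0 eps (0, R1) `^ (q + alpha)) `^ (- (2 * q)^-1).
    by rewrite -powRrM mulrN.
  apply: (cell_Lp_bound (th0 := th0) (R0 := R0) hq eg _ z0 _ _ gi (mwt (q + alpha))) => //.
  - by rewrite powR_gt0.
  - exact: measurable_rect.
  - exact: cellO.
  - by move=> x _; exact: powR_ge0.
  - move=> x Cx; have /andP[h1 _] := rvar_cell e01 R01 Cx.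
    rewrite ge0_ler_powR ?nnegrE ?(ltW r1) ?(le_trans (ltW r1) h1)//.
    by rewrite addr_ge0 ?(ltW q0)// (le_trans _ halpha)// subr_ge0 ltW.
have constE (m A X Y : R) : A * (m * X + m * Y) = m * (A * X + A * Y) by ring.
have constE2 (m A B X Y : R) : A * (m * X) + B * (m * Y) = m * (A * X + B * Y) by ring.
split; apply: Linfty_le.
- exact: (mulr_ge0 (ltW A0) (addr_ge0 (K0ge 0) K1ge)).
- rewrite [X in {ae _, forall x, _ -> _ <= X}](_ : _ = morrey_cst (2 * q) *
     (z * eps `^ gam `^ (- 2^-1) * (th0 * th0 `^ (- (2 * q)^-1) * 2 `^ 0 * R0 `^ (0 - (2 * q)^-1)) +
      z * eps `^ gam `^ (- 2^-1) * (th0 `^ (- (2 * q)^-1) * R0 `^ ((q - 1 - alpha) / (2 * q))))); last first.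
    exact: constE.
  apply: (ae_bound_Omega (eps := eps) hth0 hR0 hq halpha _ A0 A0 Wuw WuR Zu).
  + by rewrite invr_ge0 mulr_ge0// ltW.
  (* The term with u_omega carries no weight: the constant weight 1 gives [kappa] = 0. *)
  + move=> R1 R01; have := @cell_Lp_bound R th0 R0 q (eps `^ gam) 1 z
      (rect 0 th0 R1 (R1 + rvar R0 eps (0, R1))) uw (cst 1) hq eg ltr01 z0
      (measurable_rect _ _ _ _) (cellO _ R01) uwi.
    rewrite powRr0 powR1; apply => //.
    by under [X in iint _ _ X]eq_fun do rewrite mulr1.
  + exact: HR.
- exact: (addr_ge0 (mulr_ge0 (ltW A1) (K0ge kappa)) (mulr_ge0 (ltW A0) K1ge)).
- rewrite [X in {ae _, forall x, _ -> _ <= X}](_ : _ = morrey_cst (2 * q) *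
     (z * eps `^ (gam + 1) `^ (- 2^-1) * (th0 * th0 `^ (- (2 * q)^-1) * 2 `^ kappa * R0 `^ (kappa - (2 * q)^-1)) +
      z * eps `^ gam `^ (- 2^-1) * (th0 `^ (- (2 * q)^-1) * R0 `^ ((q - 1 - alpha) / (2 * q))))); last first.
    exact: constE2.
  apply: (ae_bound_Omega (eps := eps) hth0 hR0 hq halpha _ A1 A0 Wvw WvR Zv).
  + rewrite /kappa ler_pdivrMr ?mulr_gt0// [leRHS](_ : _ = 2); last by field; rewrite gt_eqF.
    by rewrite lerBlDr (le_trans hq2)// lerDl.
  + move=> R1 R01; have r1 := r1R _ R01.
    have -> : (2 * rvar R0 eps (0, R1)) `^ kappa =
        ((2 * rvar R0 eps (0, R1)) `^ (- (q / (2 * p)))) `^ (- (2 * q)^-1).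
      rewrite -powRrM; congr (_ `^ _).
      rewrite mulrNN invfM mulrCA mulrA -[_ * q / p]mulrA hp /kappa.
      by field; rewrite gt_eqF.
    apply: (cell_Lp_bound (th0 := th0) (R0 := R0) hq eg1 _ z0 _ _ vwi (mwt (- (q / (2 * p))))) => //.
    * by rewrite powR_gt0// mulr_gt0.
    * exact: measurable_rect.
    * exact: cellO.
    * by move=> x _; exact: powR_ge0.
    (* This weight decreases in r, so its lower bound on the cell comes from r <= 2 r1; hence the 2
       to the power [kappa] in [K0]. *)
    * move=> x Cx; have /andP[h1 h2] := rvar_cell e01 R01 Cx.
      apply: ge_powR_neg => //; last exact: lt_le_trans h1.
      rewrite oppr_le0 invfM mulrCA mulr_ge0 ?invr_ge0// hp subr_ge0 ltW//.
  + exact: HR.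
Qed.

Lemma Linfty_le_Znorm : exists C : R, 0 < C /\
  forall (eps delta : R) (u v uw uR vw vR rvR : R * R -> R), 0 < eps <= 1 ->
  weak_dw th0 R0 u uw -> weak_dR th0 R0 u uR ->
  weak_dw th0 R0 v vw -> weak_dR th0 R0 v vR ->
  zero_at_w0 th0 R0 u -> zero_at_w0 th0 R0 v ->
  ((eps `^ (gam / 2 + (4 * q)^-1))%:E * Linfty th0 R0 u
   + (eps `^ (gam / 2 + (4 * q)^-1 + 2^-1))%:E * Linfty th0 R0 v
   <= C%:E * Znorm th0 R0 eps gam q p alpha delta u uw uR vw vR rvR)%E.
Proof.
have K00 := K0ge 0; have K0k := K0ge kappa.
(* The final 1 makes C positive, [K0] and [K1] being known only to be nonnegative. *)
pose C := (K0 0 + K1) + (K0 kappa + K1) + 1.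
have C0 : 0 < C := ltr_wpDl (addr_ge0 (addr_ge0 K00 K1ge) (addr_ge0 K0k K1ge)) ltr01.
have q0 : 0 < q by rewrite (lt_trans _ hq).
exists C; split => // eps delta u v uw uR vw vR rvR eps01 Wuw WuR Wvw WvR Zu Zv.
have /andP[eps0 eps1] := eps01.
have main (z : R) : 0 < z ->
    (Znorm_sq th0 R0 eps gam q p alpha delta u uw uR vw vR rvR <= (z ^+ 2)%:E)%E ->
    ((eps `^ (gam / 2 + (4 * q)^-1))%:E * Linfty th0 R0 u
     + (eps `^ (gam / 2 + (4 * q)^-1 + 2^-1))%:E * Linfty th0 R0 v <= (C * z)%:E)%E.
  move=> z0 Zz.
  have [Hu Hv] := Linfty_bounds eps01 z0 Wuw WuR Wvw WvR Zu Zv Zz.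
  exact: weighted_sum_le eps01 q0 z0 K00 K1ge K0k Hu Hv.
apply: le_cst_mul_sqrt => //.
have [t3 _ _ _] := Znorm_sq_terms eps0 (lexx (Znorm_sq th0 R0 eps gam q p alpha delta u uw uR vw vR rvR)).
by apply: le_trans t3; rewrite mule_ge0 ?lee_fin ?powR_ge0 ?poweR_ge0.
Qed.

End main_estimate.

Theorem lemma2p12 (R : realType) (R0 th0 gam delta' q p delta alpha : R)
    (hR0 : 0 < R0) (hth0 : 0 < th0) (hgam : 0 < gam < 4^-1)
    (hdelta' : 0 < delta') (hq : q = 1 + delta') (hp : p^-1 + q^-1 = 1)
    (hdelta : (1 + delta')^-1 <= delta <= 1)
    (halpha : 0 < q / p /\ q / p <= alpha <= q * delta / 2) :
  exists C : R, 0 < C /\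
    forall (eps : R) (u v uw uR vw vR rvR P : R * R -> R),
      0 < eps <= 1 ->
      weak_dw th0 R0 u uw -> weak_dR th0 R0 u uR ->
      weak_dw th0 R0 v vw -> weak_dR th0 R0 v vR ->
      weak_dR th0 R0 (fun x => rvar R0 eps x * v x) rvR ->
      loc_integrable th0 R0 P ->
      boundary_conditions th0 R0 eps u v uw uR vw P ->
      divergence_free th0 R0 uw rvR ->
      ((eps `^ (gam / 2 + (4 * q)^-1))%:E * Linfty th0 R0 u
       + (eps `^ (gam / 2 + (4 * q)^-1 + 2^-1))%:E * Linfty th0 R0 v
       <= C%:E * Znorm th0 R0 eps gam q p alpha delta u uw uR vw vR rvR)%E.
Proof.
have q1 : 1 < q by rewrite hq ltrDl.
have q0 : 0 < q by rewrite (lt_trans _ q1).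
have qp : q / p = q - 1.
  have -> : p^-1 = 1 - q^-1 by rewrite -hp addrK.
  by rewrite mulrBr mulr1 divff// gt_eqF.
have [_ /andP[qa aq]] := halpha; rewrite qp in qa.
have /andP[_ d1] := hdelta.
(* The range of alpha is nonempty: q - 1 <= alpha <= q delta / 2 <= q / 2. *)
have q2 : q <= 2.
  have : q * delta <= q by rewrite ler_piMr// ltW.
  by move=> h; lra.
have [C [C0 HC]] := Linfty_le_Znorm gam hR0 hth0 q1 qp qa q2.
exists C; split => // eps u v uw uR vw vR rvR P eps01 Wuw WuR Wvw WvR _ _ [[Zu Zv] _ _ _] _.
exact: HC.
Qed.
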